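(* Let $c,\hat c\in\mathcal D_\mu$ be two points in the Reinhardt domain of convergence of the Laurent series $\hat\mu(z)$ of the measure $\mu$ on $\mathbb{T}^D$, and let $r_c=(|c_1|,\dots,|c_D|)$, $r_{\hat c}=(|\hat c_1|,\dots,|\hat c_D|)$ be the corresponding polyradii. Then for every couple of admissible times $(t,t')$ the Baker functions satisfy, with $d^Dz/\prod z$ denoting $dz_1\cdots dz_D/\prod_{a=1}^Dz_a$, $$\oint_{\mathbb{T}^D(r_c)}\Psi_1(z,t)\Psi_1^*(\bar z^{-1},t')^\dagger\frac{d^Dz}{\prod z}=\oint_{\mathbb{T}^D(r_{\hat c}^{-1})}\hat\Psi_2(z^{-1},t)\hat\Psi_2^*(\bar z,t')^\dagger\frac{d^Dz}{\prod z},$$ $$\oint_{\mathbb{T}^D(r_c)}\Psi_2(z^{-1},t)\Psi_2^*(\bar z,t')^\dagger\frac{d^Dz}{\prod z}=\oint_{\mathbb{T}^D(r_{\hat c}^{-1})}\hat\Psi_1(z,t)\hat\Psi_1^*(\bar z^{-1},t')^\dagger\frac{d^Dz}{\prod z},$$ $$\oint_{\mathbb{T}^D(r_c)}\Psi_1(z,t)\Psi_2(\bar z^{-1},t')^\dagger\frac{d^Dz}{\prod z}=\oint_{\mathbb{T}^D(r_{\hat c}^{-1})}\hat\Psi_2(z^{-1},t)\hat\Psi_1(\bar z,t')^\dagger\frac{d^Dz}{\prod z},$$ $$\oint_{\mathbb{T}^D(r_c)}\Psi_2^*(z,t)\Psi_1^*(\bar z^{-1},t')^\dagger\frac{d^Dz}{\prod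 z}=\oint_{\mathbb{T}^D(r_{\hat c}^{-1})}\hat\Psi_1^*(z^{-1},t)\hat\Psi_2^*(\bar z,t')^\dagger\frac{d^Dz}{\prod z}.$$ The orthogonal Laurent polynomials at different times satisfy $$\oint_{\mathbb{T}^D(r_c)}\Phi(z,t)\hat\Phi(\bar z^{-1},t')^\dagger e^{t(z)}\hat\mu(z)\frac{d^Dz}{\prod z}=\oint_{\mathbb{T}^D(r_{\hat c}^{-1})}\Phi(z^{-1},t)\hat\Phi(\bar z,t')^\dagger e^{t(z^{-1})}\hat\mu(z^{-1})\frac{d^Dz}{\prod z},$$ $$\oint_{\mathbb{T}^D(r_c)}\hat\Phi(z^{-1},t)\Phi(\bar z,t')^\dagger e^{\bar t(z)}\bar{\hat\mu}(z)\frac{d^Dz}{\prod z}=\oint_{\mathbb{T}^D(r_{\hat c}^{-1})}\hat\Phi(z,t)\Phi(\bar z^{-1},t')^\dagger e^{\bar t(z^{-1})}\bar{\hat\mu}(z^{-1})\frac{d^Dz}{\prod z},$$ $$\oint_{\mathbb{T}^D(r_c)}\Phi(z,t)\hat\Phi(\bar z^{-1},t')^\dagger e^{(t+t')(z)}\hat\mu(z)\frac{d^Dz}{\prod z}=\oint_{\mathbb{T}^D(r_{\hat c}^{-1})}\Phi(z^{-1},t)\hat\Phi(\bar z,t')^\dagger e^{(t+t')(z^{-1})}\hat\mu(z^{-1})\frac{d^Dz}{\prod z},$$ $$\oint_{\mathbb{T}^D(r_c)}\Phi(z,t)\hat\Phi(\bar z^{-1},t')^\dagger\hat\mu(z)\frac{d^Dz}{\prod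 z}=\oint_{\mathbb{T}^D(r_{\hat c}^{-1})}\Phi(z^{-1},t)\hat\Phi(\bar z,t')^\dagger\hat\mu(z^{-1})\frac{d^Dz}{\prod z}.$$
   Context: Let $D\ge1$, $z(\theta)=(e^{i\theta_1},\dots,e^{i\theta_D})$. For $\alpha\in\mathbb{Z}^D$ put $|\alpha|=\sum_a|\alpha_a|$, $z^\alpha=\prod_a z_a^{\alpha_a}$, $[k]=\{\alpha:|\alpha|=k\}$. Multi-indices are ordered by $|\alpha|$ and lexicographically inside each $[k]$; $\chi(z)$ is the semi-infinite column of all monomials in this order. Semi-infinite matrices have the corresponding block structure. For a polyradius $r\in(0,\infty)^D$, $\mathbb{T}^D(r)=\{z:|z_a|=r_a\ \forall a\}$; $r^{-1}$, $z^{-1}$, $\bar z^{-1}$ are componentwise. $\mu$ is a complex Borel measure on $\mathbb{T}^D$ with Fourier coefficients $c_\alpha=\frac{1}{(2\pi)^D}\oint e^{-i\alpha\cdot\theta}d\mu(\theta)$; $\hat\mu(z)=\sum_\alpha c_\alpha z^\alpha$, with Reinhardt domain of convergence $\mathcal D_\mu\subset(\mathbb{C}^* )^D$, and $\bar{\hat\mu}(z)=\sum_\alpha\overline{c_\alpha}z^\alpha$. $G=\oint\chi(z(\theta))d\mu(\theta)\chi(z(\theta))^\dagger$. Times $t=(t_\alpha)_{\alpha\in\mathbb{Z}^D}$ form a family of complex parameters; $t(z)=\sum t_\alpha z^\alpha$, $\bar t(z)=\sum\overline{t_\alpha}z^\alpha$; $(\Upsilon_\alpha)_{\beta,\gamma}=\delta_{\beta+\alpha,\gamma}$,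 $W_0(t)=\exp(\sum t_\alpha\Upsilon_\alpha)$, $G(t)=W_0(t)G=GW_0(t)$ (the moment matrix of $e^{t(z)}d\mu$). Times are admissible if $G(t)$ admits the block Gauss–Borel factorization $G(t)=S(t)^{-1}H(t)(\hat S(t)^{-1})^\dagger$ with $S,\hat S$ block lower unitriangular, $H$ block diagonal with invertible blocks (the factorization is then unique). $\Phi(z,t)=S(t)\chi(z)$, $\hat\Phi(z,t)=\hat S(t)\chi(z)$. Wave matrices: $W_1=SW_0$, $\hat W_1=\hat SW_0^\dagger$, $W_2=H^\dagger(S^{-1})^\dagger$, $\hat W_2=H(\hat S^{-1})^\dagger$ (all at time $t$). Baker and adjoint Baker functions: $\Psi_i=W_i\chi$, $\Psi_i^*=(W_i^{-1})^\dagger\chi$, $\hat\Psi_i=\hat W_i\chi$, $\hat\Psi_i^*=(\hat W_i^{-1})^\dagger\chi$, $i=1,2$. Here $\Psi_1,\hat\Psi_1,\Psi_2^*,\hat\Psi_2^*$ are considered for $z\in(\mathbb{C}^* )^D$; $\hat\Psi_2,\hat\Psi_1^*$ for $z\in\mathcal D_\mu$; $\Psi_2,\Psi_1^*$ for $z^{-1}\in\mathcal D_\mu$. Equalities are between semi-infinite matrices, entrywise. *)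

(* Defs.v *)
From HB Require Import structures.
From mathcomp Require Import all_boot all_order all_algebra.
From mathcomp Require Import all_classical all_reals all_analysis.
From mathcomp Require Import complex.

Set Implicit Arguments.
Unset Strict Implicit.
Unset Printing Implicit Defensive.

Import Order.TTheory GRing.Theory Num.Theory.
Import numFieldNormedType.Exports.

Local Open Scope classical_set_scope.
Local Open Scope ring_scope.

(* The numFieldType topology is inherited through the structure; it would not
   be found on the bare type R[i]. *)
Definition Cplx (R : realType) : numClosedFieldType := R[i].

Section Scalars.
Variable R : realType.
Local Notation C := (Cplx R).

Definition cis (x : R) : C := (cos x +i* sin x)%C.

Definition cexp (z : C) : C := (expR (complex.Re z))%:C%C * cis (complex.Im z).

Definition cintegral d (T : measurableType d) (m : {measure set T -> \bar R})
    (A : set T) (f : T -> C) : C :=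
  ((\int[m]_(x in A) complex.Re (f x)) +i*
   (\int[m]_(x in A) complex.Im (f x)))%C.

(* A finite signed measure integrates through its Jordan decomposition, which
   does not depend on the chosen Hahn decomposition. *)
Definition charge_integral d (T : measurableType d)
    (nu : {charge set T -> \bar R}) (A : set T) (f : T -> C) : C :=
  let P := cid (Hahn_decomposition nu) in
  let N := cid (projT2 P) in
  cintegral (jordan_pos (projT2 N)) A f - cintegral (jordan_neg (projT2 N)) A f.

(* A complex measure, as its (finite, signed) real and imaginary parts. *)
Record complex_measure d (T : measurableType d) := ComplexMeasure {
  cm_re : {charge set T -> \bar R};
  cm_im : {charge set T -> \bar R} }.

Definition cm_integral d (T : measurableType d) (mu : complex_measure T)
    (A : set T) (f : T -> C) : C :=
  charge_integral (cm_re mu) A f + 'i%C * charge_integral (cm_im mu) A f.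

(* The integral of f(z) dz over the circle |z| = rho, counterclockwise. *)
Definition circle_integral (rho : R) (f : C -> C) : C :=
  cintegral (@lebesgue_measure R) `[0, 2 * pi]
    (fun x : R => f (rho%:C%C * cis x) * ('i%C * rho%:C%C * cis x)).

(* The integral of F(z) dz_1 ... dz_D over |z_1| = r_1, ..., |z_D| = r_D. *)
Fixpoint torus_integral (D : nat) : 'rV[R]_D -> ('rV[C]_D -> C) -> C :=
  match D with
  | 0 => fun _ F => F 0
  | D'.+1 => fun r F =>
      circle_integral (r 0 0) (fun z =>
        torus_integral (col' 0 r)
          (fun w => F (row_mx z%:M w : 'rV[C]_(1 + D'))))
  end.

End Scalars.

Section MultiIndices.
Variables (R : realType) (D : nat).
Local Notation C := (Cplx R).
Local Notation idx := 'rV[int]_D.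
Local Notation point := 'rV[C]_D.

Definition length1 (a : idx) : nat := (\sum_(i < D) `|a 0%R i|)%N.

(* Sums over Z^D are taken block by block: limits of sums over |a| <= n. *)
Definition zsum (f : idx -> C) : C :=
  limn (fun n => \sum_(a \in [set a : idx | (length1 a <= n)%N]) f a).

Definition monom (a : idx) (z : point) : C := \prod_(i < D) z 0 i ^ a 0 i.

Definition zinv (z : point) : point := \row_i (z 0 i)^-1.
Definition zbar (z : point) : point := \row_i (z 0 i)^*.

Definition polyradius (z : point) : 'rV[R]_D := \row_i Normc.normc (z 0 i).
Definition rinv (r : 'rV[R]_D) : 'rV[R]_D := \row_i (r 0 i)^-1.

Definition laurent (u : idx -> C) (z : point) : C :=
  zsum (fun a => u a * monom a z).

Definition coef_conj (u : idx -> C) : idx -> C := fun a => (u a)^*.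

Definition laurent_summable (u : idx -> C) (z : point) : Prop :=
  summable [set: idx] (fun a => (Normc.normc (u a * monom a z))%:E).

Definition convergence_domain (u : idx -> C) : set point :=
  [set z : point | (forall i, z 0 i != 0) /\ laurent_summable u z]^°.

(* Semi-infinite matrices and columns. Rows and columns are labelled by the
   multi-indices themselves instead of by their rank in the graded
   lexicographic order, only the grading being visible in the block shapes. *)
Definition smx := idx -> idx -> C.
Definition svec := idx -> C.

Definition smx1 : smx := fun a b => (a == b)%:R.
Definition smul (A B : smx) : smx := fun a b => zsum (fun k => A a k * B k b).
Definition sapp (A : smx) (v : svec) : svec := fun a => zsum (fun k => A a k * v k).
Definition dagger (A : smx) : smx := fun a b => (A b a)^*.
Definition spow (A : smx) (n : nat) : smx := iter n (smul A) smx1.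
Definition sexp (A : smx) : smx := fun a b =>
  limn (fun n => \sum_(0 <= k < n) (k`!%:R)^-1 * spow A k a b).
Definition outer (u v : svec) : smx := fun a b => u a * (v b)^*.
Definition sscale (x : C) (A : smx) : smx := fun a b => x * A a b.

Definition block_lower_unitriangular (A : smx) : Prop :=
  forall a b, (length1 a <= length1 b)%N -> A a b = (a == b)%:R.
Definition block_diagonal (A : smx) : Prop :=
  forall a b, length1 a != length1 b -> A a b = 0.

Definition smx_inverse (A B : smx) : Prop :=
  smul A B = smx1 /\ smul B A = smx1.

(* Meant for matrices having exactly one inverse, such as the block
   lower/upper triangular ones with invertible diagonal blocks. *)
Definition sinv (A : smx) : smx := xget smx1 [set B | smx_inverse A B].

Definition gauss_borel (G S H T : smx) : Prop :=
  [/\ block_lower_unitriangular S, block_lower_unitriangular T,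
      block_diagonal H, (exists2 K, block_diagonal K & smx_inverse H K) &
      G = smul (smul (sinv S) H) (dagger (sinv T))].

Definition gauss_borel_factors (G : smx) : smx * smx * smx :=
  xget (smx1, smx1, smx1) [set X | gauss_borel G X.1.1 X.1.2 X.2].

Definition chi (z : point) : svec := fun a => monom a z.

(* The integral over T^D(r) of F(z) d^D z / (z_1 ... z_D), entrywise. *)
Definition oint (r : 'rV[R]_D) (F : point -> smx) : smx := fun a b =>
  torus_integral r (fun z => F z a b / \prod_(i < D) z 0 i).

Definition Upsilon (a : idx) : smx := fun b g => (b + a == g)%:R.
Definition W0 (t : idx -> C) : smx :=
  sexp (fun b g => zsum (fun a => t a * Upsilon a b g)).

End MultiIndices.

Notation torus_angles R D := (D.-tuple (measurableTypeR R)).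

Section Baker.
Variables (R : realType) (D : nat).
Local Notation C := (Cplx R).
Local Notation idx := 'rV[int]_D.
Local Notation point := 'rV[C]_D.
(* The torus T^D is [0, 2 pi)^D through theta |-> z(theta); what mu does outside
   of this cube is irrelevant. *)
Variable mu : complex_measure R (torus_angles R D).

Definition angle_cube : set (torus_angles R D) :=
  [set theta | forall i, (0 : R) <= tnth theta i < 2 * pi].

Definition torus_point (theta : torus_angles R D) : point :=
  \row_i cis (tnth theta i).

Definition fourier : idx -> C := fun a =>
  ((2 * pi) ^+ D)^-1%:C%C *
  cm_integral mu angle_cube
    (fun theta => cis (- \sum_(i < D) (a 0 i)%:~R * (tnth theta i : R))).

Definition mu_hat : point -> C := laurent fourier.
Definition mu_hat_bar : point -> C := laurent (coef_conj fourier).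
Definition reinhardt_domain : set point := convergence_domain fourier.

Definition moment_matrix : smx R D := fun a b =>
  cm_integral mu angle_cube
    (fun theta => outer (chi (torus_point theta)) (chi (torus_point theta)) a b).

Variable t : idx -> C.

Definition moment_matrix_at : smx R D := smul (W0 t) moment_matrix.

Definition admissible : Prop :=
  exists S H T, gauss_borel moment_matrix_at S H T.

Definition Sm : smx R D := (gauss_borel_factors moment_matrix_at).1.1.
Definition Hm : smx R D := (gauss_borel_factors moment_matrix_at).1.2.
Definition hSm : smx R D := (gauss_borel_factors moment_matrix_at).2.

Definition Phi (z : point) : svec R D := sapp Sm (chi z).
Definition hPhi (z : point) : svec R D := sapp hSm (chi z).

Definition W1 : smx R D := smul Sm (W0 t).
Definition hW1 : smx R D := smul hSm (dagger (W0 t)).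
Definition W2 : smx R D := smul (dagger Hm) (dagger (sinv Sm)).
Definition hW2 : smx R D := smul Hm (dagger (sinv hSm)).

(* W1 and hW1 are neither row-finite nor column-finite and may have several
   inverses; theirs is the product of the inverses of the factors, where
   W0(t)^-1 = exp(- sum_a t_a Upsilon_a) = W0(- t). *)
Definition W0inv : smx R D := W0 (fun a => - t a).
Definition W1inv : smx R D := smul W0inv (sinv Sm).
Definition hW1inv : smx R D := smul (dagger W0inv) (sinv hSm).

Definition Psi1 (z : point) : svec R D := sapp W1 (chi z).
Definition Psi2 (z : point) : svec R D := sapp W2 (chi z).
Definition hPsi1 (z : point) : svec R D := sapp hW1 (chi z).
Definition hPsi2 (z : point) : svec R D := sapp hW2 (chi z).

Definition Psi1s (z : point) : svec R D := sapp (dagger W1inv) (chi z).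
Definition Psi2s (z : point) : svec R D := sapp (dagger (sinv W2)) (chi z).
Definition hPsi1s (z : point) : svec R D := sapp (dagger hW1inv) (chi z).
Definition hPsi2s (z : point) : svec R D := sapp (dagger (sinv hW2)) (chi z).

End Baker.

(* Main.v *)
(* Every integrand is the sum on the torus of an absolutely convergent Laurent
   series, and the integral of such a sum against [d^D z / (z_1 ... z_D)] is
   [(2 pi i)^D] times its constant coefficient. Both sides of each identity come
   from the same Laurent coefficients, summed at [|z| = |c|] on the left and at
   [|z| = |c'|], after [z |-> 1/z], on the right.

   The Baker functions are such sums because [W0 t] and the moment matrix are
   block Toeplitz, with symbols [e^t] and [(2 pi)^D mu_hat], hence so is
   [G = G(t)]. From [G = S^-1 H T^-dagger] one gets
   [hW2 = H T^-dagger = S G] and, with the block upper triangular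
   [N = T^dagger H^-1 = hW2^-1], [S^-1 = G N] and [W1^-1 = W0^-1 G N]: up to
   taking inverse adjoints, every wave matrix is a block lower triangular matrix
   times a Toeplitz one. Taking adjoints,
   [G^dagger = T^-1 H^dagger S^-dagger] exchanges the roles of S and T and gives
   the other wave matrices. *)
Require Import Defs.
From mathcomp Require Import all_boot all_order all_algebra.
From mathcomp Require Import all_classical all_reals all_analysis.
From mathcomp Require Import complex.
From mathcomp Require Import measurable_realfun ring zify.

Set Implicit Arguments.
Unset Strict Implicit.
Unset Printing Implicit Defensive.

Import Order.TTheory GRing.Theory Num.Theory.
Import numFieldNormedType.Exports.

Local Open Scope ring_scope.

(** * Unordered sums of complex families *)

Section FiniteSums.
Variables (V : nmodType) (I : eqType).

(** [zsum], [smul] and [sexp] are limits of partial sums, with a default value when these diverge,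
    and [W0] and the moment matrix are full in both directions, so neither associativity nor
    exchange of sums is free. Every rearrangement is paid for by absolute summability: the work is
    done with unordered sums [hsum], from which values of [zsum] are read off. Brackets move in
    three situations: two adjacent triangular factors on the proper side, a lower factor on the left
    with an upper one on the right, or Toeplitz factors whose symbols converge at a common point.
    Hence the detour through [S^-1 = G N]: [W0inv S^-1] is a full matrix times a lower one, whereas
    [W0inv (G N)] can be regrouped, and [W0inv G] is Toeplitz with symbol [e^-t e^t M = M]. Such
    identities of symbols are checked pointwise on one torus and pass to the coefficients by
    uniqueness. No contour is deformed between the two tori: one coefficient family sums on both. *)

Lemma big_uniq_sub (u : I -> V) (s s' : seq I) :
  uniq s -> uniq s' -> {subset s <= s'} ->
  \sum_(i <- s') u i = \sum_(i <- s) u i + \sum_(i <- s' | i \notin s) u i.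
Proof.
move=> us us' ss'; rewrite (bigID (mem s)) /=; congr (_ + _).
rewrite -big_filter; apply: perm_big; apply: uniq_perm => //.
  exact: filter_uniq.
move=> i; rewrite mem_filter /=; apply: andb_idr; exact: ss'.
Qed.

End FiniteSums.

Section UnorderedSums.
Variable R : realType.
Local Notation C := (Cplx R).

(** Convergence along the directed set of finite subsets, coded as duplicate-free sequences. No
    enumeration is chosen, so one notion serves for naturals, integers, multi-indices and pairs. *)
Definition hsum (I : eqType) (u : I -> C) (S : C) : Prop :=
  forall e : C, 0 < e -> exists s0 : seq I, forall s, uniq s ->
    {subset s0 <= s} -> `|\sum_(i <- s) u i - S| < e.

(** The explicit bound is kept because it is submultiplicative under convolution, which the
    exponential series relies on. The order of [C] forces [M] to be real. *)
Definition abs_bounded (I : eqType) (u : I -> C) (M : C) : Prop :=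
  forall s, uniq s -> \sum_(i <- s) `|u i| <= M.

Definition abs_summable (I : eqType) (u : I -> C) : Prop :=
  exists M, abs_bounded u M.

Lemma hsum_unique (I : eqType) (u : I -> C) S T : hsum u S -> hsum u T -> S = T.
Proof.
move=> uS uT; apply/eqP; rewrite -subr_eq0 -normr_eq0; apply/negPn/negP => n0.
have e0 : 0 < `|S - T| / 2%:R by rewrite divr_gt0 ?ltr0n // lt_def n0 normr_ge0.
have [s1 h1] := uS _ e0; have [s2 h2] := uT _ e0.
pose s := undup (s1 ++ s2).
have us : uniq s by exact: undup_uniq.
have /h1 {}h1 : {subset s1 <= s} by move=> i si; rewrite mem_undup mem_cat si.
have /h2 {}h2 : {subset s2 <= s} by move=> i si; rewrite mem_undup mem_cat si orbT.
have := ltrD (h1 us) (h2 us); rewrite -splitr distrC => /(le_lt_trans (ler_normD _ _)).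
by rewrite addrA subrK ltxx.
Qed.

Lemma hsumD (I : eqType) (u v : I -> C) S T : hsum u S -> hsum v T ->
  hsum (fun i => u i + v i) (S + T).
Proof.
move=> uS vT e e0; have e20 : 0 < e / 2%:R by rewrite divr_gt0 ?ltr0n.
have [s1 h1] := uS _ e20; have [s2 h2] := vT _ e20.
exists (s1 ++ s2) => s us ss.
rewrite big_split /= opprD addrACA.
rewrite (splitr e); apply: le_lt_trans (ler_normD _ _) _.
by apply: ltrD; [apply: h1|apply: h2] => // i si; apply: ss; rewrite mem_cat si ?orbT.
Qed.

Lemma hsumZ (I : eqType) (c : C) (u : I -> C) S : hsum u S ->
  hsum (fun i => c * u i) (c * S).
Proof.
(* The [+ 1] covers [c = 0]. *)
move=> uS e e0; have c0 : 0 < `|c| + 1 by rewrite ltr_wpDl.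
have [s0 h] := uS _ (divr_gt0 e0 c0).
exists s0 => s us ss; rewrite -mulr_sumr -mulrBr normrM.
apply: le_lt_trans (_ : (`|c| + 1) * `|\sum_(i <- s) u i - S| < _).
  by rewrite ler_wpM2r // lerDl.
by rewrite mulrC -ltr_pdivlMr // h.
Qed.

Lemma hsum_conj (I : eqType) (u : I -> C) S : hsum u S ->
  hsum (fun i => (u i)^*) (S^*).
Proof.
move=> uS e /uS[s0 h]; exists s0 => s us ss.
by rewrite -rmorph_sum -rmorphB norm_conjC h.
Qed.

Lemma eq_hsum (I : eqType) (u v : I -> C) S : u =1 v -> hsum u S -> hsum v S.
Proof. by move=> /funext ->. Qed.

Lemma hsum_fin (I : eqType) (s : seq I) (u : I -> C) : uniq s ->
  (forall i, i \notin s -> u i = 0) -> hsum u (\sum_(i <- s) u i).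
Proof.
move=> us u0 e e0; exists s => s' us' ss'.
rewrite (big_uniq_sub u us us' ss') [X in _ + X - _]big1 //.
by rewrite addr0 subrr normr0.
Qed.

Lemma abs_summable_fin (I : eqType) (s : seq I) (u : I -> C) : uniq s ->
  (forall i, i \notin s -> u i = 0) -> abs_summable u.
Proof.
move=> us u0; exists (\sum_(i <- s) `|u i|) => s' us'.
rewrite (bigID (mem s)) /= [X in _ + X]big1 ?addr0; last first.
  by move=> i /u0 ->; rewrite normr0.
rewrite -big_filter [leRHS](@big_uniq_sub _ _ _ [seq i <- s' | i \in s])//.
- by rewrite lerDl sumr_ge0.
- exact: filter_uniq.
- by move=> i; rewrite mem_filter => /andP[].
Qed.

Lemma abs_bounded_le (I : eqType) (u v : I -> C) M :
  (forall i, `|u i| <= `|v i|) -> abs_bounded v M -> abs_bounded u M.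
Proof. by move=> uv vM s us; apply: le_trans (vM s us); apply: ler_sum. Qed.

Lemma abs_summable_le (I : eqType) (u v : I -> C) :
  (forall i, `|u i| <= `|v i|) -> abs_summable v -> abs_summable u.
Proof. by move=> uv [M vM]; exists M; apply: abs_bounded_le vM. Qed.

Lemma abs_summableD (I : eqType) (u v : I -> C) :
  abs_summable u -> abs_summable v -> abs_summable (fun i => u i + v i).
Proof.
move=> [M uM] [N vN]; exists (M + N) => s us.
apply: le_trans (lerD (uM s us) (vN s us)).
by rewrite -big_split /=; apply: ler_sum => i _; exact: ler_normD.
Qed.

(** Shares an error [e] among the terms of [s]; the successor in the denominator covers the empty
    sequence. *)
Lemma sum_const_le (I : eqType) (s : seq I) (e : C) : 0 <= e ->
  \sum_(i <- s) e / (size s).+1%:R <= e.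
Proof.
move=> e0; rewrite -mulr_sumr -[leRHS]mulr1 ler_wpM2l //.
rewrite big_const_seq count_predT iter_addr_0 -(mulr_natl _^-1).
by rewrite ler_pdivrMr ?ltr0n // mul1r ler_nat.
Qed.

Lemma abs_boundedZ (I : eqType) (c : C) (u : I -> C) M :
  abs_bounded u M -> abs_bounded (fun i => c * u i) (`|c| * M).
Proof.
move=> uM s us; rewrite (eq_bigr _ (fun i _ => normrM _ _)) -mulr_sumr.
by rewrite ler_wpM2l // uM.
Qed.

Lemma abs_summableZ (I : eqType) (c : C) (u : I -> C) :
  abs_summable u -> abs_summable (fun i => c * u i).
Proof. by move=> [M uM]; exists (`|c| * M); exact: abs_boundedZ. Qed.

Lemma abs_bounded_ge0 (I : eqType) (u : I -> C) M : abs_bounded u M -> 0 <= M.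
Proof. by move=> /(_ [::] isT); rewrite big_nil. Qed.

Lemma normc_real (x : R) : `|x%:C%C : C| = (`|x|)%:C%C.
Proof. by rewrite normc_def /= expr0n /= addr0 sqrtr_sqr. Qed.

(** The sum is the supremum of the finite partial sums: a finite set that nearly attains it only
    gets closer when enlarged, the terms being nonnegative. *)
Lemma hsum_real_ge0 (I : eqType) (p : I -> R) (M : R) : (forall i, 0 <= p i) ->
  (forall s, uniq s -> \sum_(i <- s) p i <= M) ->
  exists S : R, hsum (fun i => (p i)%:C%C) S%:C%C.
Proof.
move=> p0 pM.
pose E := [set x : R | exists2 s : seq I, uniq s & x = \sum_(i <- s) p i]%classic.
have E0 : has_sup E.
  split; first by exists 0, [::]; rewrite ?big_nil.
  by exists M => x [s us ->]; exact: pM.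
exists (sup E) => e e0.
have eE : e = (complex.Re e)%:C%C by rewrite RRe_real // gtr0_real.
move: e0; rewrite eE ltcR => e0.
have [x [s0 us0 xE] xs] := sup_adherent e0 E0.
exists s0 => s us ss.
rewrite -[X in X - _](rmorph_sum (real_complex R)) -(rmorphB (real_complex R)).
rewrite normc_real ltcR distrC ger0_norm; last first.
  by rewrite subr_ge0; apply: ub_le_sup; [case: E0|exists s].
rewrite ltrBlDr -ltrBlDl; apply: lt_le_trans xs _.
by rewrite xE (big_uniq_sub p us0 us ss) lerDl sumr_ge0.
Qed.

Lemma abs_summable_hsum (I : eqType) (u : I -> C) :
  abs_summable u -> exists S, hsum u S.
Proof.
move=> [M uM].
have MR : M = (complex.Re M)%:C%C by rewrite RRe_real // ger0_real // (abs_bounded_ge0 uM).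
(* To be used for the real and the imaginary part. *)
have part (f : C -> R) : (forall z, (`|f z|)%:C%C <= `|z|) ->
    exists S, hsum (fun i => (f (u i))%:C%C) S.
  move=> fle.
  (* To be used for [f] and [- f]: their positive parts are nonnegative families whose difference is
     [f]. *)
  have half (g : C -> R) : (forall z, `|g z| <= `|f z|) ->
      exists S, hsum (fun i => (Num.max (g (u i)) 0)%:C%C) S.
    move=> gle.
    have [|s us|S ?] :=
      @hsum_real_ge0 I (fun i => Num.max (g (u i)) 0) (complex.Re M);
      last by exists S%:C%C.
      by move=> i; rewrite le_max lexx orbT.
    rewrite -lecR -MR; apply: le_trans (uM s us).
    rewrite [X in X <= _](rmorph_sum (real_complex R)); apply: ler_sum => i _.
    apply: le_trans (fle (u i)); rewrite /= lecR.
    by apply: le_trans (gle (u i)); rewrite ge_max ler_norm normr_ge0.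
  have [S1 h1] := half f (fun z => lexx _).
  have [|S2 h2] := half (fun z => - f z); first by move=> z; rewrite normrN.
  exists (S1 + -1 * S2); apply: eq_hsum (hsumD h1 (hsumZ (-1) h2)) => i.
  rewrite mulN1r -(rmorphB (real_complex R)) /=; congr (_%:C%C).
  rewrite /Num.max oppr_lt0; case: ltgtP => [_|_|->];
    by rewrite ?subr0 ?opprK ?add0r ?sub0r ?opprK.
have [S1 h1] := part (@complex.Re R) (@normc_ge_Re R).
have [|S2 h2] := part (@complex.Im R).
  move=> z; rewrite (_ : complex.Im z = complex.Re (- ('i%C * z))); last first.
    by case: z => a b; rewrite /= !mul0r !mul1r sub0r opprK.
  apply: le_trans (normc_ge_Re _) _.
  by rewrite normrN normrM normc_def /= expr0n /= add0r expr1n sqrtr1 mul1r.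
exists (S1 + 'i%C * S2); apply: eq_hsum (hsumD h1 (hsumZ _ h2)) => i.
by rewrite -complexE.
Qed.

Section Pairs.
Variables I J : eqType.

(** A finite set of pairs lies in a finite rectangle, which is summed row by row. *)
Lemma abs_bounded_pair (u : I * J -> C) (B : I -> C) M :
  (forall i, abs_bounded (fun j => u (i, j)) (B i)) -> abs_bounded B M ->
  abs_bounded u M.
Proof.
move=> uB BM s us.
pose s1 := undup (map fst s); pose s2 := undup (map snd s).
have u12 : uniq (allpairs pair s1 s2).
  by apply: allpairs_uniq; rewrite ?undup_uniq // => -[? ?] [? ?] _ _ [-> ->].
have sub : {subset s <= allpairs pair s1 s2}.
  move=> x xs; apply/allpairsP; exists x.
  by split; rewrite ?mem_undup ?map_f //; case: x {xs}.
have := big_uniq_sub (fun x => `|u x|) us u12 sub.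
move=> us_le; apply: (@le_trans _ _ (\sum_(i <- allpairs pair s1 s2) `|u i|)).
  by rewrite us_le lerDl sumr_ge0.
rewrite big_allpairs /=; apply: le_trans (BM s1 (undup_uniq _)).
apply: ler_sum => i _; apply: le_trans (uB i s2 (undup_uniq _)) _.
by rewrite ger0_norm // (abs_bounded_ge0 (uB i)).
Qed.

(** Fubini for a family whose total sum is known to exist. For a given finite set [s] of rows, a
    rectangle over [s] approximates both the total and each of the row sums. *)
Lemma hsum_pair (u : I * J -> C) (S : I -> C) T :
  (forall i, hsum (fun j => u (i, j)) (S i)) -> hsum u T -> hsum S T.
Proof.
move=> uS uT e e0; have e20 : 0 < e / 2%:R by rewrite divr_gt0 ?ltr0n.
have [s0 h0] := uT _ e20.
exists (map fst s0) => s us ss.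
have d0 : 0 < e / 2%:R / (size s).+1%:R by rewrite divr_gt0 ?ltr0n.
have /choice[J_ hJ] : forall i, exists Ji : seq J, forall t, uniq t ->
    {subset Ji <= t} ->
    `|\sum_(j <- t) u (i, j) - S i| < e / 2%:R / (size s).+1%:R.
  by move=> i; exact: uS.
(* Columns that cover [s0] and make every row of [s] accurate at once. *)
pose t := undup (map snd s0 ++ flatten (map J_ s)).
have ut : uniq t by exact: undup_uniq.
have -> : \sum_(i <- s) S i - T = (\sum_(x <- allpairs pair s t) u x - T)
    - \sum_(i <- s) (\sum_(j <- t) u (i, j) - S i).
  by rewrite big_allpairs /= sumrB; ring.
apply: le_lt_trans (ler_normB _ _) _; rewrite [ltRHS](splitr e).
apply: ltr_leD.
  apply: h0; first by apply: allpairs_uniq => // -[? ?] [? ?] _ _ [-> ->].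
  move=> -[i j] x0; apply/allpairsP; exists (i, j); split=> //=.
    by apply: ss; apply/mapP; exists (i, j).
  by rewrite mem_undup mem_cat; apply/orP; left; apply/mapP; exists (i, j).
apply: le_trans (ler_norm_sum _ _ _) _.
apply: (@le_trans _ _ (\sum_(i <- s) (e / 2%:R / (size s).+1%:R))).
  rewrite big_seq [leRHS]big_seq; apply: ler_sum => i si; apply/ltW/hJ => // j jJ.
  rewrite mem_undup mem_cat; apply/orP; right.
  by apply/flattenP; exists (J_ i) => //; exact: map_f.
exact/sum_const_le/ltW.
Qed.

(** The triangle inequality on finite rectangles, passed to the limit; the bound [M] is
    preserved. *)
Lemma abs_bounded_rowsum (u : I * J -> C) (S : I -> C) M :
  (forall i, hsum (fun j => u (i, j)) (S i)) -> abs_bounded u M ->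
  abs_bounded S M.
Proof.
move=> uS uM s us; apply/ler_addgt0Pr => e e0.
have d0 : 0 < e / (size s).+1%:R by rewrite divr_gt0 ?ltr0n.
have /choice[J_ hJ] : forall i, exists Ji : seq J, forall t, uniq t ->
    {subset Ji <= t} -> `|\sum_(j <- t) u (i, j) - S i| < e / (size s).+1%:R.
  by move=> i; exact: uS.
pose t := undup (flatten (map J_ s)).
have ut : uniq t by exact: undup_uniq.
have up : uniq (allpairs pair s t) by apply: allpairs_uniq => // -[? ?] [? ?] _ _ [-> ->].
apply: le_trans (lerD (uM _ up) (lexx e)); rewrite big_allpairs /=.
apply: (@le_trans _ _ (\sum_(i <- s) (\sum_(j <- t) `|u (i, j)| + e / (size s).+1%:R))).
  rewrite big_seq [leRHS]big_seq; apply: ler_sum => i si.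
  have hi := hJ i t ut; rewrite distrC in hi.
  apply: (@le_trans _ _ (`|\sum_(j <- t) u (i, j)| + `|S i - \sum_(j <- t) u (i, j)|)).
    by apply: le_trans (ler_normD _ _); rewrite addrC subrK.
  apply: lerD; first exact: ler_norm_sum.
  apply/ltW/hi => j jJ; rewrite mem_undup.
  by apply/flattenP; exists (J_ i) => //; exact: map_f.
by rewrite big_split /= lerD2l; exact/sum_const_le/ltW.
Qed.

Lemma abs_bounded_prod (x : I -> C) (y : J -> C) M N :
  abs_bounded x M -> abs_bounded y N ->
  abs_bounded (fun ij : I * J => x ij.1 * y ij.2) (M * N).
Proof.
move=> xM yN; apply: (@abs_bounded_pair _ (fun i => `|x i| * N)) => [i|s us] /=.
  exact: abs_boundedZ.
rewrite (eq_bigr (fun i => `|x i| * N)); last first.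
  by move=> i _; rewrite ger0_norm // mulr_ge0 // (abs_bounded_ge0 yN).
by rewrite -mulr_suml ler_wpM2r ?(abs_bounded_ge0 yN) // xM.
Qed.

Lemma abs_summable_prod (x : I -> C) (y : J -> C) :
  abs_summable x -> abs_summable y ->
  abs_summable (fun ij : I * J => x ij.1 * y ij.2).
Proof. by move=> [M xM] [N yN]; exists (M * N); exact: abs_bounded_prod. Qed.

Lemma hsum_prod (x : I -> C) (y : J -> C) X Y :
  abs_summable x -> abs_summable y -> hsum x X -> hsum y Y ->
  hsum (fun ij : I * J => x ij.1 * y ij.2) (X * Y).
Proof.
move=> ax ay xX yY.
have [T uT] := abs_summable_hsum (abs_summable_prod ax ay).
suff -> : X * Y = T by [].
(* Summing the product family by rows gives [Y * x i], whose sum is known. *)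
rewrite mulrC; apply: (@hsum_unique _ (fun i => Y * x i)); first exact: hsumZ.
by apply: hsum_pair uT => i /=; rewrite mulrC; exact: hsumZ.
Qed.

(** A partial inverse lets finite sequences of [J] be pulled back to [I] by [pmap]. *)
Lemma pinv_exists (g : I -> J) : injective g ->
  exists h : J -> option I, pcancel g h /\ ocancel h g.
Proof.
move=> ginj.
exists (fun j => if pselect (exists i, g i = j) is left P
                 then Some (projT1 (cid P)) else None); split.
  move=> i; case: pselect => [P|[]]; last by exists i.
  by congr Some; apply: ginj; exact: projT2 (cid P).
by move=> j; case: pselect => //= P; exact: projT2 (cid P).
Qed.

Lemma big_pmap_inj (W : nmodType) (g : I -> J) (h : J -> option I) (v : J -> W) s :
  pcancel g h -> ocancel h g -> (forall j, v j != 0 -> exists i, j = g i) ->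
  \sum_(j <- s) v j = \sum_(i <- pmap h s) v (g i).
Proof.
move=> gh hg v0; elim: s => [|j s ih] /=; first by rewrite !big_nil.
rewrite big_cons; case hj: (h j) => [i|] /=.
  by rewrite big_cons ih -{1}(hg j) hj.
rewrite ih; case: (eqVneq (v j) 0) => [->|/v0[i ji]]; first by rewrite add0r.
by move: hj; rewrite ji gh.
Qed.

(** The general change of index: [g] only has to reach the support of [v]. It covers bijections such
    as translations of the lattice, and also the embedding [(k, l) -> (k + l, k)] of pairs of
    naturals. *)
Lemma hsum_inj (g : I -> J) (v : J -> C) S : injective g ->
  (forall j, v j != 0 -> exists i, j = g i) ->
  hsum (fun i => v (g i)) S -> hsum v S.
Proof.
move=> ginj v0 vS e /vS[s0 h0]; have [h [gh hg]] := pinv_exists ginj.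
exists (map g s0) => s us ss; rewrite (big_pmap_inj _ gh hg v0).
apply: h0 => [|i i0]; first exact: (pmap_uniq hg).
by rewrite mem_pmap; apply/mapP; exists (g i); rewrite ?gh // ss // map_f.
Qed.

Lemma abs_bounded_inj (g : I -> J) (v : J -> C) M : injective g ->
  (forall j, v j != 0 -> exists i, j = g i) ->
  abs_bounded (fun i => v (g i)) M -> abs_bounded v M.
Proof.
move=> ginj v0 vM s us; have [h [gh hg]] := pinv_exists ginj.
rewrite (@big_pmap_inj _ g h _ _ gh hg); first exact: vM (pmap_uniq hg us).
by move=> j; rewrite normr_eq0; exact: v0.
Qed.

Lemma abs_summable_inj (g : I -> J) (v : J -> C) : injective g ->
  (forall j, v j != 0 -> exists i, j = g i) ->
  abs_summable (fun i => v (g i)) -> abs_summable v.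
Proof. by move=> ginj v0 [M vM]; exists M; apply: abs_bounded_inj vM. Qed.

Lemma abs_summable_comp (g : I -> J) (v : J -> C) : injective g ->
  abs_summable v -> abs_summable (fun i => v (g i)).
Proof.
move=> ginj [M vM]; exists M => s us.
by rewrite -(big_map g predT (fun j => `|v j|)); apply: vM; rewrite map_inj_uniq.
Qed.

End Pairs.

Lemma abs_summable_swap (I J : eqType) (u : I * J -> C) :
  abs_summable (fun x : J * I => u (x.2, x.1)) -> abs_summable u.
Proof.
move=> h; apply: (@abs_summable_inj _ _ (fun x : J * I => (x.2, x.1))) h.
  by move=> [? ?] [? ?] [-> ->].
by move=> [i j] _; exists (j, i).
Qed.

(** Both iterated sums equal the sum of the double family, which exists by absolute summability. *)
Lemma hsum_exchange (I J : eqType) (u : I * J -> C) (S : I -> C) (S' : J -> C) T :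
  abs_summable u ->
  (forall i, hsum (fun j => u (i, j)) (S i)) ->
  (forall j, hsum (fun i => u (i, j)) (S' j)) -> hsum S T -> hsum S' T.
Proof.
move=> au uS uS' ST; have [T' uT'] := abs_summable_hsum au.
have -> : T = T' by apply: hsum_unique ST (hsum_pair uS uT').
apply: (@hsum_pair _ _ (fun x : J * I => u (x.2, x.1))) => //.
apply: (@hsum_inj _ _ (fun x : I * J => (x.2, x.1))).
- by move=> [? ?] [? ?] [-> ->].
- by move=> [j i] _; exists (i, j).
- by apply: eq_hsum uT' => -[].
Qed.

(** The situation of a row of a block lower matrix followed by an arbitrary matrix: finitely many
    [i], each with a summable row. *)
Lemma abs_summable_finl (I J : eqType) (s : seq I) (u : I * J -> C) : uniq s ->
  (forall i j, i \notin s -> u (i, j) = 0) ->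
  (forall i, abs_summable (fun j => u (i, j))) -> abs_summable u.
Proof.
move=> us u0 /choice[B uB].
exists (\sum_(i <- s) `|B i|).
(* The chosen bounds [B i] are cut to zero outside [s], so that their sum is finite. *)
apply: (@abs_bounded_pair _ _ _ (fun i => B i *+ (i \in s))) => [i|s' us'].
  case: (boolP (i \in s)) => [_|is_]; first by rewrite mulr1n.
  by move=> t _; rewrite mulr0n big1 // => j _; rewrite u0 ?normr0.
have h i : i \notin s -> (B i *+ (i \in s)) = 0 by move=> /negPf ->.
rewrite (bigID (mem s)) /= [X in _ + X]big1 ?addr0; last first.
  by move=> i /h ->; rewrite normr0.
rewrite -big_filter [leRHS](@big_uniq_sub _ _ _ [seq i <- s' | i \in s])//.
- rewrite ler_wpDr ?sumr_ge0 // big_filter [leRHS]big_filter; apply: ler_sum => i ->.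
  by rewrite mulr1n.
- exact: filter_uniq.
- by move=> i; rewrite mem_filter => /andP[].
Qed.

Lemma abs_summable_finr (I J : eqType) (s : seq J) (u : I * J -> C) : uniq s ->
  (forall i j, j \notin s -> u (i, j) = 0) ->
  (forall j, abs_summable (fun i => u (i, j))) -> abs_summable u.
Proof.
move=> us u0 au; apply: abs_summable_swap.
by apply: (@abs_summable_finl _ _ s) => // i j; exact: u0.
Qed.

(** Link with ordinary limits along any exhausting sequence of finite sets: balls for multi-indices,
    initial segments for naturals, symmetric windows for integers. *)
Lemma hsum_cvg (I : eqType) (u : I -> C) S (s_ : nat -> seq I) :
  (forall n, uniq (s_ n)) ->
  (forall i, exists N, forall n, (N <= n)%N -> i \in s_ n) ->
  hsum u S -> ((fun n => \sum_(i <- s_ n) u i) @ \oo --> S)%classic.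
Proof.
move=> us /choice[N hN] uS; apply/cvgrPdist_lt => e e0.
have [s0 h0] := uS _ e0.
exists (\max_(i <- s0) N i)%N => // n /= nN; rewrite distrC; apply: h0 => // i is0.
by apply: hN; apply: leq_trans nN; exact: leq_bigmax_seq.
Qed.

Lemma hsum_lim (I : eqType) (u : I -> C) S (s_ : nat -> seq I) :
  (forall n, uniq (s_ n)) ->
  (forall i, exists N, forall n, (N <= n)%N -> i \in s_ n) ->
  hsum u S -> (limn (fun n => \sum_(i <- s_ n) u i))%classic = S.
Proof.
move=> us h /(hsum_cvg us h) uS; apply: cvg_lim uS; exact: norm_hausdorff.
Qed.

Lemma hsum_series (u : nat -> C) S : hsum u S ->
  limn (fun n => \sum_(0 <= k < n) u k) = S.
Proof.
move=> uS; apply: (hsum_lim (s_ := index_iota 0)) uS => [n|i]; first exact: iota_uniq.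
by exists i.+1 => n; rewrite mem_index_iota.
Qed.

End UnorderedSums.

(** * Block sums over the lattice of multi-indices *)

Section MultiIndexSums.
Variables (R : realType) (D : nat).
Local Notation C := (Cplx R).
Local Notation idx := 'rV[int]_D.

(** The ball is cut out of the cube of multi-indices with coordinates between [- n] and [n], which a
    finite function type enumerates. *)
Definition ball_seq (n : nat) : seq idx :=
  [seq a <- undup [seq (\row_i ((f i)%:Z - n%:Z)) |
     f : {ffun 'I_D -> 'I_(n + n).+1}] | (length1 a <= n)%N].

Lemma ball_seq_uniq n : uniq (ball_seq n).
Proof. by rewrite filter_uniq // undup_uniq. Qed.

Lemma mem_ball_seq n (a : idx) : (a \in ball_seq n) = (length1 a <= n)%N.
Proof.
rewrite mem_filter; apply: andb_idr => an; rewrite mem_undup.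
have bd i : (absz (a ord0 i + n%:Z)%R < (n + n).+1)%N /\ 0 <= a ord0 i + n%:Z.
  have : (absz (a ord0 i) <= n)%N.
    by apply: leq_trans an; rewrite /length1 (bigD1 i) //= leq_addr.
  by case: (a ord0 i) => k; lia.
apply/mapP; exists [ffun i => Ordinal (bd i).1]; first by rewrite mem_enum.
by apply/rowP => i; rewrite !mxE ffunE /= gez0_abs ?(bd i).2 // addrK.
Qed.

Lemma hsum_zsum (u : idx -> C) S : hsum u S -> zsum u = S.
Proof.
move=> uS; rewrite /zsum -(hsum_lim ball_seq_uniq _ uS); last first.
  by move=> a; exists (length1 a) => n; rewrite mem_ball_seq.
congr (limn _); apply/funext => n; rewrite (fsbig_seq _ _ (ball_seq_uniq n)).
by apply: eq_fsbigl; apply/seteqP; split=> a /=; rewrite mem_ball_seq.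
Qed.

Lemma zsumP (u : idx -> C) : abs_summable u -> hsum u (zsum u).
Proof. by move=> /abs_summable_hsum[S uS]; rewrite (hsum_zsum uS). Qed.

Lemma zsum_conj (u : idx -> C) : abs_summable u ->
  zsum (fun a => (u a)^*) = (zsum u)^*.
Proof. by move=> /zsumP/hsum_conj/hsum_zsum. Qed.

Lemma zsumZ (c : C) (u : idx -> C) : abs_summable u ->
  zsum (fun a => c * u a) = c * zsum u.
Proof. by move=> /zsumP /hsumZ h; exact/hsum_zsum. Qed.

Lemma zsum_fin (s : seq idx) (u : idx -> C) : uniq s ->
  (forall i, i \notin s -> u i = 0) -> zsum u = \sum_(i <- s) u i.
Proof. by move=> us u0; exact/hsum_zsum/hsum_fin. Qed.

Lemma zsum1 (b : idx) (u : idx -> C) :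
  (forall i, i != b -> u i = 0) -> zsum u = u b.
Proof.
move=> u0; rewrite (@zsum_fin [:: b]) ?big_seq1 // => i.
by rewrite inE => /u0.
Qed.

(** Source of all associativity laws for [smul] and [sapp]: both sides are iterated sums of the
    triple product, so its absolute summability suffices. *)
Lemma zsum_assoc (x y : idx -> C) (B : idx -> idx -> C) :
  abs_summable (fun kl : idx * idx => x kl.1 * B kl.1 kl.2 * y kl.2) ->
  zsum (fun l => zsum (fun k => x k * B k l) * y l) =
  zsum (fun k => x k * zsum (fun l => B k l * y l)).
Proof.
move=> au; pose u kl : C := x kl.1 * B kl.1 kl.2 * y kl.2.
have rowE k : x k * zsum (fun l => B k l * y l) = zsum (fun l => u (k, l)).
  (* The inner sum may diverge where [x k] vanishes; its default value is then multiplied by 0.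
     Elsewhere division by [x k] makes the inner sum absolutely convergent. *)
  have [x0|x0] := eqVneq (x k) 0.
    by rewrite x0 mul0r (@zsum1 0) /u /= ?x0 ?mul0r // => i _; rewrite !mul0r.
  rewrite -zsumZ; first by congr zsum; apply/funext => l; rewrite mulrA.
  apply: (@abs_summable_le _ _ _ (fun l => (x k)^-1 * u (k, l))) => [l|].
    by rewrite /u /= -!mulrA mulKf.
  by apply: abs_summableZ; apply: (abs_summable_comp (g := pair k)) au => ? ? [].
have colE l : zsum (fun k => x k * B k l) * y l = zsum (fun k => u (k, l)).
  have [y0|y0] := eqVneq (y l) 0.
    by rewrite y0 mulr0 (@zsum1 0) /u /= ?y0 ?mulr0 // => i _; rewrite !mulr0.
  rewrite mulrC -zsumZ; first by congr zsum; apply/funext => k; rewrite mulrC.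
  apply: (@abs_summable_le _ _ _ (fun k => (y l)^-1 * u (k, l))) => [k|].
    by rewrite /u /= [X in _ <= `|X|]mulrC mulfK.
  by apply: abs_summableZ; apply: (abs_summable_comp (g := pair^~ l)) au => ? ? [].
rewrite (_ : (fun l => _) = fun l => zsum (fun k => u (k, l))); last exact/funext.
rewrite [in RHS](_ : (fun k => _) = fun k => zsum (fun l => u (k, l))); last exact/funext.
have ar k : abs_summable (fun l => u (k, l)).
  by apply: (abs_summable_comp (g := pair k)) au => ? ? [].
have ac l : abs_summable (fun k => u (k, l)).
  by apply: (abs_summable_comp (g := pair^~ l)) au => ? ? [].
apply: hsum_zsum; apply: (hsum_exchange au).
- by move=> k; exact/zsumP/ar.
- by move=> l; exact/zsumP/ac.
apply: zsumP; case: au => M uM; exists M; apply: abs_bounded_rowsum uM => k.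
exact/zsumP/ar.
Qed.

End MultiIndexSums.

(** * Integrals of Laurent series over tori *)

Section CircleIntegral.
Variable R : realType.
Local Notation C := (Cplx R).
Local Notation mu := (@lebesgue_measure R).

Lemma cisD (x y : R) : cis (x + y) = cis x * cis y.
Proof.
rewrite /cis cosD sinD; apply/eqP.
by rewrite eq_complex /= eqxx [X in _ == X]addrC eqxx.
Qed.

Lemma cis0 : cis (0 : R) = 1.
Proof. by rewrite /cis cos0 sin0. Qed.

Lemma norm_cis (x : R) : `|cis x| = 1.
Proof. by rewrite normc_def /= cos2Dsin2 sqrtr1. Qed.

Lemma cis_neq0 (x : R) : cis x != 0.
Proof. by rewrite -normr_eq0 norm_cis oner_neq0. Qed.

Lemma cisN (x : R) : cis (- x) = (cis x)^-1.
Proof. by apply: (mulIf (cis_neq0 x)); rewrite mulVf ?cis_neq0 // -cisD addNr cis0. Qed.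

Lemma cisMn (n : nat) (x : R) : cis (n%:R * x) = cis x ^+ n.
Proof.
elim: n => [|n ih]; first by rewrite mul0r cis0 expr0.
by rewrite -addn1 natrD mulrDl mul1r cisD ih exprD expr1.
Qed.

Lemma cisMz (k : int) (x : R) : cis (k%:~R * x) = cis x ^ k.
Proof.
case: k => n; first exact: cisMn.
by rewrite -[RHS]/((cis x ^+ n.+1)^-1) -cisMn NegzE mulrNz mulNr cisN.
Qed.

Lemma cis_2pi : cis (2 * pi : R) = 1.
Proof. by rewrite /cis mulr_natl cos2pi sin2pi. Qed.

Lemma conj_cis (x : R) : (cis x)^* = cis (- x).
Proof. by rewrite /cis cosN sinN. Qed.

Lemma normrXz (x : C) (k : int) : `|x ^ k| = `|x| ^ k.
Proof. by case: k => n; rewrite ?NegzE /exprz ?normrX // normfV normrX. Qed.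

Lemma pi2_gt0 : (0 : R) < 2 * pi.
Proof. by rewrite mulr_gt0 // pi_gt0. Qed.

Lemma is_derive_trig (a b k x : R) :
  is_derive x 1 (fun y => a * sin (k * y) + b * cos (k * y))
    (k * (a * cos (k * x) - b * sin (k * x))).
Proof.
have dk : is_derive x 1 ( *%R k) k.
  by apply: (@is_derive_eq _ _ _ (k \*: id)); rewrite /= -[RHS]mulr1.
have ds : is_derive x 1 (sin \o *%R k) (cos (k * x) * k) by exact: is_derive1_comp.
have dc : is_derive x 1 (cos \o *%R k) (- sin (k * x) * k) by exact: is_derive1_comp.
apply: (@is_derive_eq _ _ _ (a \*: (sin \o *%R k) + b \*: (cos \o *%R k))).
by rewrite /GRing.scale /=; ring.
Qed.

Lemma continuous_trig (a b k : R) :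
  continuous (fun x : R => a * cos (k * x) - b * sin (k * x)).
Proof.
move=> x; have := @is_derive_trig (- b) a k x.
move=> dF; have /derivable1_diffP/differentiable_continuous h := @ex_derive _ _ _ _ _ _ _ dF.
suff -> : (fun x => a * cos (k * x) - b * sin (k * x)) =
  (fun y : R => - b * sin (k * y) + a * cos (k * y)) by [].
by apply/funext => y; rewrite mulNr addrC.
Qed.

Lemma Re_mul_cis (w : C) (y : R) :
  complex.Re (w * cis y) = complex.Re w * cos y - complex.Im w * sin y.
Proof. by case: w. Qed.

(** Orthogonality of characters: for [k] nonzero the integrand has the antiderivative [F], which
    takes the same value at 0 and at [2 pi]. *)
Lemma integral_cis (w : C) (k : int) :
  (\int[mu]_(x in `[0%R, (2 * pi)%R]) (complex.Re (w * cis x ^ k))%:E =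
   ((2 * pi * complex.Re w) *+ (k == 0))%:E)%E.
Proof.
have fE x : complex.Re (w * cis x ^ k) =
    complex.Re w * cos (k%:~R * x) - complex.Im w * sin (k%:~R * x).
  by rewrite -cisMz Re_mul_cis.
under eq_integral do rewrite fE.
set a := complex.Re w; set b := complex.Im w.
have [->|k0] := eqVneq k 0.
  under eq_integral do rewrite mul0r cos0 sin0 mulr0 mulr1 subr0.
  rewrite integral_cst //= lebesgue_measure_itv /= lte_fin pi2_gt0.
  by rewrite -EFinD subr0 -EFinM mulrC mulr1n.
have kr0 : k%:~R != 0 :> R by rewrite intr_eq0.
pose F (y : R) : R := (a / k%:~R) * sin (k%:~R * y) + (b / k%:~R) * cos (k%:~R * y).
have dF (x : R) : is_derive x 1 F (a * cos (k%:~R * x) - b * sin (k%:~R * x)).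
  by apply: is_derive_eq (is_derive_trig _ _ _ _) _; field.
have cF : continuous F.
  by move=> x; have /derivable1_diffP/differentiable_continuous := @ex_derive _ _ _ _ _ _ _ (dF x).
rewrite (@continuous_FTC2 R _ F 0 (2 * pi) pi2_gt0); first last.
- by move=> x _; rewrite derive1E; exact: derive_val.
- split; first by move=> x _; exact: ex_derive.
  + by apply: cvg_at_right_filter; exact: cF.
  + by apply: cvg_at_left_filter; exact: cF.
- exact/continuous_subspaceT/continuous_trig.
have : cis (k%:~R * (2 * pi : R)) = 1 by rewrite cisMz cis_2pi exp1rz.
case=> ck sk; rewrite mulr0n /F ck sk !mulr0 sin0 cos0 mulr0.
by rewrite -EFinB subrr.
Qed.

Lemma integrable_cis (w : C) (k : int) :
  mu.-integrable `[0, 2 * pi]%classic (fun x : R => (complex.Re (w * cis x ^ k))%:E).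
Proof.
have -> : (fun x : R => (complex.Re (w * cis x ^ k))%:E) =
  EFin \o (fun x : R => complex.Re w * cos (k%:~R * x) - complex.Im w * sin (k%:~R * x)).
  by apply/funext => x /=; rewrite -cisMz Re_mul_cis.
apply: continuous_compact_integrable; first exact: segment_compact.
exact/continuous_subspaceT/continuous_trig.
Qed.

Lemma ReD (x y : C) : complex.Re (x + y) = complex.Re x + complex.Re y.
Proof. by case: x y => [? ?] []. Qed.

Lemma Re_sum (I : Type) (s : seq I) (f : I -> C) :
  complex.Re (\sum_(i <- s) f i) = \sum_(i <- s) complex.Re (f i).
Proof. exact: (big_morph _ ReD erefl). Qed.

Lemma integrable_trig_poly (w : int -> C) (s : seq int) :
  mu.-integrable `[0, 2 * pi]%classic
    (fun x : R => (complex.Re (\sum_(k <- s) w k * cis x ^ k))%:E).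
Proof.
rewrite (_ : (fun x : R => _) =
  (fun x : R => \sum_(k <- s) (complex.Re (w k * cis x ^ k))%:E)%E).
  by apply: integrable_sum => // k _; exact: integrable_cis.
by apply/funext => x; rewrite Re_sum sumEFin.
Qed.

Lemma integral_trig_poly (w : int -> C) (s : seq int) : uniq s ->
  (\int[mu]_(x in `[0%R, (2 * pi)%R]) (complex.Re (\sum_(k <- s) w k * cis x ^ k))%:E =
   ((2 * pi * complex.Re (w 0%Z)) *+ (0%Z \in s))%:E)%E.
Proof.
elim: s => [_|k s ih /andP[ks us]].
  by under eq_integral do rewrite big_nil; rewrite integral0.
rewrite (_ : (fun x : R => _) = (fun x : R => (complex.Re (w k * cis x ^ k))%:E +
    (complex.Re (\sum_(j <- s) w j * cis x ^ j))%:E)%E); last first.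
  by apply/funext => x; rewrite big_cons ReD EFinD.
rewrite integralD //; [|exact: integrable_cis|exact: integrable_trig_poly].
rewrite integral_cis ih // -EFinD inE eq_sym; congr (_%:E).
have [k0|k0] /= := eqVneq k 0; last by rewrite mulr0n add0r.
by move: ks; rewrite k0 => /negPf ->; rewrite addr0.
Qed.

(** Termwise integration by dominated convergence; the constant [M] bounds all partial sums because
    [cis x] has modulus 1. *)
Lemma integral_Re_series (w : int -> C) (G : R -> C) :
  abs_summable w -> (forall x, hsum (fun k => w k * cis x ^ k) (G x)) ->
  (\int[mu]_(x in `[0%R, (2 * pi)%R]) (complex.Re (G x))%:E =
   (2 * pi * complex.Re (w 0%Z))%:E)%E.
Proof.
move=> [M wM] wG.
pose s_ n : seq int := [seq (i%:Z - n%:Z) | i <- iota 0 (n + n).+1].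
have us n : uniq (s_ n).
  by rewrite map_inj_uniq ?iota_uniq // => i j /addIr [].
have s_ex (k : int) : exists N, forall n, (N <= n)%N -> k \in s_ n.
  exists `|k|%N => n kn; apply/mapP; exists (absz (k + n%:Z)); last lia.
  by rewrite mem_iota; lia.
pose P n x : R := complex.Re (\sum_(k <- s_ n) w k * cis x ^ k).
have P_cvg x : (P ^~ x @ \oo --> complex.Re (G x))%classic.
  apply/cvgrPdist_lt => e e0.
  have e0C : (0 : C) < e%:C%C by rewrite ltcR.
  have /cvgrPdist_lt/(_ _ e0C) := hsum_cvg us s_ex (wG x).
  apply: filterS => n; rewrite -ltcR; apply: le_lt_trans.
  apply: le_trans (normc_ge_Re _); rewrite lecR.
  rewrite le_eqVlt; apply/orP; left; apply/eqP; congr (`|_|); rewrite /P.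
  by case: (G x) (\sum_(_ <- _) _) => ? ? [].
have MR : M = (complex.Re M)%:C%C.
  by rewrite RRe_real // ger0_real // (abs_bounded_ge0 wM).
have P_le n x : `|P n x| <= complex.Re M.
  rewrite -lecR -MR; apply: le_trans (normc_ge_Re _) _.
  apply: le_trans (ler_norm_sum _ _ _) _; apply: le_trans (wM _ (us n)).
  by apply: ler_sum => k _; rewrite normrM normrXz norm_cis exp1rz mulr1.
have mP n : measurable_fun `[0%R, (2 * pi)%R]%classic (P n).
  by have /measurable_int/measurable_EFinP := integrable_trig_poly w (s_ n).
have [] := @dominated_convergence _ _ _ mu `[0%R, (2 * pi)%R]%classic _
  (fun n x => (P n x)%:E) (fun x => (complex.Re (G x))%:E)
  (cst (complex.Re M)%:E).
- exact: measurable_itv.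
- by move=> n; apply/measurable_EFinP; exact: mP.
- apply/measurable_EFinP; apply: (measurable_fun_cvg mP) => x _; exact: P_cvg.
- apply/aeW => x _; apply: cvg_EFin; first exact: nearW.
  exact: P_cvg.
- have := @continuous_compact_integrable R (cst (complex.Re M)) `[0%R, (2 * pi)%R]%classic.
  by apply; [exact: segment_compact|exact/continuous_subspaceT/cst_continuous].
- by apply/aeW => x n _; rewrite lee_fin; exact: P_le.
move=> _ _ h.
rewrite -(cvg_lim (@ereal_hausdorff R) h).
(* Once the window contains the index 0, the integrals of the partial sums no longer change. *)
have [N hN] := s_ex 0%Z.
apply: (cvg_lim (@ereal_hausdorff R)); apply: cvg_near_cst.
by exists N => // n /= nN; rewrite integral_trig_poly // hN.
Qed.

Lemma cintegral_series (w : int -> C) (G : R -> C) :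
  abs_summable w -> (forall x, hsum (fun k => w k * cis x ^ k) (G x)) ->
  cintegral mu `[0%R, (2 * pi)%R]%classic G = (2 * pi)%:C%C * w 0%Z.
Proof.
move=> aw wG; rewrite /cintegral /Rintegral.
have ImE (z : C) : complex.Im z = complex.Re (- 'i%C * z).
  by case: z => a b /=; rewrite oppr0 mul0r sub0r mulNr opprK mul1r.
rewrite (integral_Re_series aw wG).
rewrite (_ : (fun x => (complex.Im (G x))%:E) =
  fun x => (complex.Re (- 'i%C * G x))%:E); last by apply/funext => x; rewrite ImE.
rewrite (@integral_Re_series (fun k => - 'i%C * w k)); first last.
- by move=> x; apply: eq_hsum (hsumZ (- 'i%C) (wG x)) => k; rewrite mulrA.
- exact: abs_summableZ.
rewrite -ImE /=; case: (w 0%Z) => a b; apply/eqP.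
by rewrite eq_complex /= !mul0r subr0 addr0 !eqxx.
Qed.

Lemma circle_integral_series (rho : R) (v : int -> C) (F K : C -> C) :
  0 < rho ->
  (forall z : C, `|z| = rho%:C%C ->
    [/\ abs_summable (fun k => v k * z ^ k), hsum (fun k => v k * z ^ k) (F z) &
        K z = F z / z]) ->
  circle_integral rho K = (2 * pi)%:C%C * 'i%C * v 0%Z.
Proof.
move=> rho0 vF.
have rho_cis x : `|rho%:C%C * cis x : C| = rho%:C%C.
  by rewrite normrM norm_cis mulr1 normc_real gtr0_norm.
rewrite /circle_integral.
rewrite (@cintegral_series (fun k => 'i%C * (v k * rho%:C%C ^ k))).
- by rewrite expr0z mulr1 mulrA.
- have [+ _ _] := vF _ (rho_cis 0).
  by move=> h; apply: abs_summableZ; move: h; rewrite cis0 mulr1.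
- move=> x; have [_ h ->] := vF _ (rho_cis x).
  have nz : rho%:C%C * cis x != 0 :> C.
    by rewrite -normr_eq0 rho_cis; apply/eqP => -[] /eqP; rewrite gt_eqF.
  (* The factor [i z] of [dz = i z dx] cancels the division by [z] in [K]. *)
  rewrite -['i%C * _ * _]mulrA mulrCA divfK //.
  apply: eq_hsum (hsumZ 'i%C h) => k.
  by rewrite expfzMl !mulrA.
Qed.

End CircleIntegral.

Section LaurentSums.
Variable R : realType.
Local Notation C := (Cplx R).

(** Counterpart of [zsum] for other index types: integers in the circle variable, naturals in the
    exponential series. *)
Definition usum (I : eqType) (u : I -> C) : C := xget 0 [set S | hsum u S]%classic.

Lemma usumP (I : eqType) (u : I -> C) : abs_summable u -> hsum u (usum u).
Proof. by move=> /abs_summable_hsum[S uS]; rewrite /usum; case: xgetP => // /(_ S). Qed.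

Definition on_torus D (r : 'rV[R]_D) (z : 'rV[C]_D) : Prop :=
  forall i, `|z 0 i| = (r 0 i)%:C%C.

(** The coefficients are an explicit argument, so that one family can be shown to represent a
    function on several tori. *)
Definition laurent_sum D (r : 'rV[R]_D) (u : 'rV[int]_D -> C)
    (F : 'rV[C]_D -> C) : Prop :=
  forall z, on_torus r z ->
    abs_summable (fun a => u a * monom a z) /\ hsum (fun a => u a * monom a z) (F z).

Definition row_cons (T : nmodType) D (x : T) (w : 'rV[T]_D) : 'rV[T]_D.+1 :=
  \row_(i < D.+1) if unlift ord0 i is Some j then w 0 j else x.

Lemma row_cons0 (T : nmodType) D (x : T) (w : 'rV[T]_D) : row_cons x w 0 0 = x.
Proof. by rewrite mxE unlift_none. Qed.

Lemma row_consS (T : nmodType) D (x : T) (w : 'rV[T]_D) i :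
  row_cons x w 0 (lift ord0 i) = w 0 i.
Proof. by rewrite mxE liftK. Qed.

Lemma row_mx_cons (T : nmodType) D (x : T) (w : 'rV[T]_D) :
  (row_mx x%:M w : 'rV[T]_(1 + D)) = row_cons x w.
Proof.
apply/rowP => i; case: (unliftP ord0 i) => [j|] ->.
  by rewrite row_consS -rshift1 row_mxEr.
rewrite row_cons0; transitivity ((row_mx x%:M w : 'rV[T]_(1 + D)) 0 (lshift D ord0)).
  by congr (row_mx _ _ _ _); exact/val_inj.
by rewrite row_mxEl mxE.
Qed.

Lemma row_cons_inj (T : nmodType) D (x y : T) (w v : 'rV[T]_D) :
  row_cons x w = row_cons y v -> x = y /\ w = v.
Proof.
move=> e; split; first by rewrite -(row_cons0 x w) e row_cons0.
by apply/rowP => i; rewrite -(row_consS x w) e row_consS.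
Qed.

Lemma row_consK (T : nmodType) D (w : 'rV[T]_D.+1) :
  row_cons (w 0 0) (col' 0 w) = w.
Proof.
apply/rowP => i; case: (unliftP ord0 i) => [j|] ->; last by rewrite row_cons0.
by rewrite row_consS mxE.
Qed.

Lemma monom_cons D (k : int) (a : 'rV[int]_D) (z : C) (w : 'rV[C]_D) :
  monom (row_cons k a) (row_cons z w) = z ^ k * monom a w.
Proof.
rewrite /monom big_ord_recl !row_cons0; congr (_ * _).
by apply: eq_bigr => i _; rewrite !row_consS.
Qed.

Lemma monom_neq0 D (a : 'rV[int]_D) (z : 'rV[C]_D) :
  (forall i, z 0 i != 0) -> monom a z != 0.
Proof. by move=> z0; apply/prodf_neq0 => i _; exact: expfz_neq0. Qed.

Lemma on_torus_neq0 D (r : 'rV[R]_D) z i : (forall i, 0 < r 0 i) ->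
  on_torus r z -> z 0 i != 0.
Proof.
by move=> r0 /(_ i) zr; rewrite -normr_eq0 zr; apply/eqP => -[] /eqP; rewrite gt_eqF.
Qed.

(** Induction on [D]: for fixed [z] the series is regrouped by the exponent of the remaining
    variables, the inner integral extracts the row of exponent 0, and the circle integral extracts
    its constant term. *)
Lemma torus_integral_laurent D (r : 'rV[R]_D) u (F K : 'rV[C]_D -> C) :
  (forall i, 0 < r 0 i) -> laurent_sum r u F ->
  (forall z, on_torus r z -> K z = F z / \prod_(i < D) z 0 i) ->
  torus_integral r K = ((2 * pi)%:C%C * 'i%C) ^+ D * u 0.
Proof.
elim: D r u F K => [|D ih] r u F K r0 uF KF.
  have t0 : on_torus r 0 by move=> [].
  rewrite /= KF // big_ord0 divr1 expr0 mul1r.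
  have [_ uF0] := uF _ t0; apply: hsum_unique uF0 _.
  have -> : u 0 = \sum_(i <- [:: 0 : 'rV[int]_0]) u i * monom i 0.
    by rewrite big_seq1 /monom big_ord0 mulr1.
  by apply: hsum_fin => // i; rewrite thinmx0 inE eqxx.
have rs0 i : 0 < (col' 0 r) 0 i by rewrite mxE.
(* Dividing by the monomials of one point of the inner torus yields summability in the first
   exponent alone. *)
have w_ex : exists w, on_torus (col' 0 r) w.
  exists (\row_i ((col' 0 r) 0 i)%:C%C) => i.
  by rewrite mxE normc_real gtr0_norm.
have cons_torus z w : `|z| = (r 0 0)%:C%C -> on_torus (col' 0 r) w ->
    on_torus r (row_cons z w).
  move=> zr wr i; case: (unliftP ord0 i) => [j|] ->; last by rewrite row_cons0.
  by rewrite row_consS wr mxE.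
have as_pair z w : `|z| = (r 0 0)%:C%C -> on_torus (col' 0 r) w ->
    abs_summable (fun x : 'rV[int]_D * int =>
      u (row_cons x.2 x.1) * z ^ x.2 * monom x.1 w) /\
    hsum (fun x : 'rV[int]_D * int =>
      u (row_cons x.2 x.1) * z ^ x.2 * monom x.1 w) (F (row_cons z w)).
  move=> zr wr; have [au hu] := uF _ (cons_torus _ _ zr wr).
  have E : (fun x : 'rV[int]_D * int => u (row_cons x.2 x.1) * z ^ x.2 * monom x.1 w)
      = fun x => u (row_cons x.2 x.1) * monom (row_cons x.2 x.1) (row_cons z w).
    by apply/funext => x; rewrite monom_cons mulrA.
  rewrite E; split.
    apply: (abs_summable_comp (g := fun x : _ * _ => row_cons x.2 x.1)) au.
    by move=> [? ?] [? ?] /= /row_cons_inj[-> ->].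
  apply: (@hsum_inj _ _ _ (fun a : 'rV[int]_D.+1 => (col' 0 a, a 0 0))).
  - by move=> a b [ab ab0]; rewrite -(row_consK a) ab ab0 row_consK.
  - move=> [a k] _; exists (row_cons k a); rewrite row_cons0; congr (_, _).
    by apply/rowP => i; rewrite mxE row_consS.
  - by apply: eq_hsum hu => a /=; rewrite row_consK.
have a_row z a : `|z| = (r 0 0)%:C%C ->
    abs_summable (fun k => u (row_cons k a) * z ^ k).
  move=> zr; have [w wr] := w_ex; have [+ _] := as_pair _ _ zr wr.
  move=> /(abs_summable_comp (g := pair a)) au.
  have m0 := monom_neq0 a (fun i => on_torus_neq0 i rs0 wr).
  apply: (abs_summable_le _ (abs_summableZ (monom a w)^-1 (au _))) => [k|? ? []//].
  by rewrite /= [X in _ <= `|X|]mulrC mulfK.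
(* Coefficient of exponent [a] in the remaining variables, [z] being fixed. *)
pose c z a := usum (fun k => u (row_cons k a) * z ^ k).
pose M : C := ((2 * pi)%:C%C * 'i%C) ^+ D.
rewrite /= (@circle_integral_series _ (r 0 0) (fun k => M * u (row_cons k 0))
  (fun z => M * c z 0)) //.
  rewrite mulrA -exprS; congr (_ * u _); apply/rowP => i.
  by case: (unliftP ord0 i) => [j|] ->; rewrite ?row_cons0 ?row_consS !mxE.
move=> z zr.
have z0 : z != 0.
  by rewrite -normr_eq0 zr; apply/eqP => -[] /eqP; rewrite gt_eqF.
split.
- have := abs_summableZ M (a_row z 0 zr).
  by apply: abs_summable_le => k; rewrite mulrA.
- by apply: eq_hsum (hsumZ M (usumP (a_row z 0 zr))) => k; rewrite mulrA.
(* The factor [z^-1] coming from [dz / z] is put into the coefficients of the inner series. *)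
rewrite (ih _ (fun a => z^-1 * c z a) (fun w => z^-1 * F (row_cons z w))) //.
- by rewrite mulrCA mulrC.
- move=> w wr; have [[N au] hu] := as_pair _ _ zr wr.
  have hrow a : hsum (fun k => u (row_cons k a) * z ^ k * monom a w) (c z a * monom a w).
    rewrite mulrC; apply: eq_hsum (hsumZ (monom a w) (usumP (a_row z a zr))) => k.
    by rewrite mulrC.
  have E : (fun a => z^-1 * c z a * monom a w) = fun a => z^-1 * (c z a * monom a w).
    by apply/funext => a; rewrite mulrA.
  rewrite E; split.
    by apply: abs_summableZ; exists N; apply: abs_bounded_rowsum au.
  by apply: hsumZ; apply: hsum_pair hu.
- move=> w wr; rewrite row_mx_cons KF; last exact: cons_torus.
  rewrite big_ord_recl row_cons0 invfM mulrA [F _ / z]mulrC.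
  by congr (_ / _); apply: eq_bigr => i _; rewrite row_consS.
Qed.

End LaurentSums.

(** * Algebra of Laurent series *)

Section LaurentAlgebra.
Variables (R : realType) (D : nat).
Local Notation C := (Cplx R).
Local Notation idx := 'rV[int]_D.
Local Notation point := 'rV[C]_D.
Implicit Types (u v : idx -> C) (F G : point -> C) (r s : 'rV[R]_D) (z : point).

Lemma monomD (a b : idx) (z : point) : (forall i, z 0 i != 0) ->
  monom (a + b) z = monom a z * monom b z.
Proof.
by move=> z0; rewrite /monom -big_split /=; apply: eq_bigr => i _; rewrite mxE expfzDr.
Qed.

Lemma monom0 (z : point) : monom 0 z = 1.
Proof. by rewrite /monom big1 // => i _; rewrite mxE expr0z. Qed.

Lemma monom_inv (a : idx) (z : point) : monom a (zinv z) = monom (- a) z.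
Proof.
rewrite /monom; apply: eq_bigr => i _; by rewrite !mxE exprz_inv.
Qed.

Lemma conjXz (x : C) (k : int) : (x ^ k)^* = x^* ^ k.
Proof. by case: k => n; rewrite /exprz /= ?fmorphV rmorphXn. Qed.

Lemma monom_conj (a : idx) (z : point) : monom a (zbar z) = (monom a z)^*.
Proof.
rewrite /monom rmorph_prod; apply: eq_bigr => i _; rewrite !mxE.
by rewrite [RHS]conjXz.
Qed.

Lemma zinvK (z : point) : zinv (zinv z) = z.
Proof. by apply/rowP => i; rewrite !mxE invrK. Qed.

Lemma zbarK (z : point) : zbar (zbar z) = z.
Proof. by apply/rowP => i; rewrite !mxE conjCK. Qed.

Lemma zbar_inv (z : point) : zbar (zinv z) = zinv (zbar z).
Proof. by apply/rowP => i; rewrite !mxE fmorphV. Qed.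

Lemma on_torus_inv r z : on_torus r z -> on_torus (rinv r) (zinv z).
Proof. by move=> zr i; rewrite !mxE normfV zr -fmorphV. Qed.

Lemma on_torus_conj r z : on_torus r z -> on_torus r (zbar z).
Proof. by move=> zr i; rewrite !mxE norm_conjC. Qed.

Lemma rinvK r : rinv (rinv r) = r.
Proof. by apply/rowP => i; rewrite !mxE invrK. Qed.

Definition cauchy_prod u v : idx -> C := fun a => zsum (fun k => u k * v (a - k)).

(** The bijection [(k, m) -> (k + m, k)] turns the product of the two series into the convolution,
    with the product of the bounds. *)
Lemma cauchy_family u v z M N : (forall i, z 0 i != 0) ->
  abs_bounded (fun a => u a * monom a z) M ->
  abs_bounded (fun a => v a * monom a z) N ->
  abs_bounded (fun ak : idx * idx => u ak.2 * v (ak.1 - ak.2) * monom ak.1 z) (M * N).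
Proof.
move=> z0 uM vN.
apply: (@abs_bounded_inj _ _ _ (fun km : idx * idx => (km.1 + km.2, km.1))).
- by move=> [k m] [k' m'] /= [+ kk']; rewrite kk' => /addrI ->.
- by move=> [a k] _; exists (k, a - k); rewrite /= addrC subrK.
have := abs_bounded_prod uM vN; congr abs_bounded; apply/funext => -[k m] /=.
by rewrite addrC addKr monomD // mulrACA.
Qed.

Lemma cauchy_summable u v z a : (forall i, z 0 i != 0) ->
  abs_summable (fun a => u a * monom a z) ->
  abs_summable (fun a => v a * monom a z) ->
  abs_summable (fun k => u k * v (a - k)).
Proof.
move=> z0 [M uM] [N vN].
have au : abs_summable _ := ex_intro _ _ (cauchy_family z0 uM vN).
have {}au := abs_summable_comp (g := pair a) (fun _ _ => fun e => congr1 snd e) au.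
apply: abs_summable_le (abs_summableZ (monom a z)^-1 au) => k /=.
by rewrite [X in _ <= `|X|]mulrC mulfK // monom_neq0.
Qed.

Lemma cauchy_abs_bounded u v z M N : (forall i, z 0 i != 0) ->
  abs_bounded (fun a => u a * monom a z) M ->
  abs_bounded (fun a => v a * monom a z) N ->
  abs_bounded (fun a => cauchy_prod u v a * monom a z) (M * N).
Proof.
move=> z0 uM vN; apply: abs_bounded_rowsum (cauchy_family z0 uM vN) => a /=.
rewrite mulrC.
have := hsumZ (monom a z) (zsumP (cauchy_summable a z0 (ex_intro _ _ uM) (ex_intro _ _ vN))).
by apply: eq_hsum => k; rewrite mulrC.
Qed.

Lemma cauchy_hsum u v z U V : (forall i, z 0 i != 0) ->
  abs_summable (fun a => u a * monom a z) -> hsum (fun a => u a * monom a z) U ->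
  abs_summable (fun a => v a * monom a z) -> hsum (fun a => v a * monom a z) V ->
  hsum (fun a => cauchy_prod u v a * monom a z) (U * V).
Proof.
move=> z0 au hu av hv.
apply: (@hsum_pair _ _ _ (fun ak : idx * idx => u ak.2 * v (ak.1 - ak.2) * monom ak.1 z)).
  move=> a; rewrite /= mulrC.
  have := hsumZ (monom a z) (zsumP (cauchy_summable a z0 au av)).
  by apply: eq_hsum => k; rewrite mulrC.
apply: (@hsum_inj _ _ _ (fun km : idx * idx => (km.1 + km.2, km.1))).
- by move=> [k m] [k' m'] /= [+ kk']; rewrite kk' => /addrI ->.
- by move=> [a k] _; exists (k, a - k); rewrite /= addrC subrK.
apply: eq_hsum (hsum_prod au av hu hv) => -[k m] /=.
by rewrite addrC addKr monomD // mulrACA.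
Qed.

Lemma laurent_sumM r u v F G : (forall i, 0 < r 0 i) ->
  laurent_sum r u F -> laurent_sum r v G ->
  laurent_sum r (cauchy_prod u v) (fun z => F z * G z).
Proof.
move=> r0 uF vG z zr; have z0 i := on_torus_neq0 i r0 zr.
have [au hu] := uF _ zr; have [av hv] := vG _ zr.
split; last exact: cauchy_hsum.
by case: au av => M uM [N vN]; exists (M * N); exact: cauchy_abs_bounded.
Qed.

Lemma laurent_sum_ext r u F G : (forall z, on_torus r z -> F z = G z) ->
  laurent_sum r u F -> laurent_sum r u G.
Proof. by move=> FG uF z zr; rewrite -FG //; exact: uF. Qed.

Lemma laurent_sumZ r u F (c : C) : laurent_sum r u F ->
  laurent_sum r (fun a => c * u a) (fun z => c * F z).
Proof.
move=> uF z /uF[au hu].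
have -> : (fun a => c * u a * monom a z) = (fun a => c * (u a * monom a z)).
  by apply/funext => a; rewrite mulrA.
by split; [exact: abs_summableZ|exact: hsumZ].
Qed.

Lemma laurent_sum_laurent r u F : laurent_sum r u F -> laurent_sum r u (laurent u).
Proof. by move=> uF z /uF[au hu]; split=> //; exact: zsumP. Qed.

Lemma laurent_sumE r u F z : laurent_sum r u F -> on_torus r z -> laurent u z = F z.
Proof. by move=> uF /uF[_] /hsum_zsum. Qed.

Lemma laurent_sum_inv r u F : laurent_sum r u F ->
  laurent_sum (rinv r) (fun a => u (- a)) (fun z => F (zinv z)).
Proof.
move=> uF z zr; have /uF[au hu] : on_torus r (zinv z).
  by rewrite -(rinvK r); exact: on_torus_inv.
have E a : u (- a) * monom a z = u (- a) * monom (- a) (zinv z).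
  by rewrite monom_inv opprK.
split.
  apply: abs_summable_le (abs_summable_comp (@oppr_inj idx) au) => a.
  by rewrite E.
apply: (@hsum_inj _ _ _ (fun a : idx => - a)); first exact: oppr_inj.
  by move=> a _; exists (- a); rewrite opprK.
by apply: eq_hsum hu => a; rewrite E opprK.
Qed.

Lemma laurent_sum_conj r u F : laurent_sum r u F ->
  laurent_sum r (coef_conj u) (fun z => (F (zbar z))^*).
Proof.
move=> uF z zr; have [au hu] := uF _ (on_torus_conj zr).
have E a : coef_conj u a * monom a z = (u a * monom a (zbar z))^*.
  by rewrite monom_conj [RHS]rmorphM /= conjCK.
split; last by apply: eq_hsum (hsum_conj hu) => a; rewrite E.
by apply: abs_summable_le au => a; rewrite E norm_conjC.
Qed.

Lemma laurent_sum_shift r u F (b : idx) : (forall i, 0 < r 0 i) ->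
  laurent_sum r u F ->
  laurent_sum r (fun a => u (a + b)) (fun z => F z / monom b z).
Proof.
move=> r0 uF z zr; have [au hu] := uF _ zr; have z0 i := on_torus_neq0 i r0 zr.
have E a : u (a + b) * monom a z = (monom b z)^-1 * (u (a + b) * monom (a + b) z).
  by rewrite (monomD a b z0) [monom a z * _]mulrC mulrCA mulKf ?monom_neq0.
have Ef : (fun a => u (a + b) * monom a z) =
    fun a => (monom b z)^-1 * (u (a + b) * monom (a + b) z).
  exact/funext.
rewrite Ef; split.
  apply: abs_summableZ; apply: (abs_summable_comp (g := fun a : idx => a + b)) au.
  exact: addIr.
rewrite [F z / _]mulrC; apply: hsumZ.
apply: (@hsum_inj _ _ _ (fun a : idx => a - b)).
- exact: addIr.
- by move=> a _; exists (a + b); rewrite addrK.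
- by apply: eq_hsum hu => a; rewrite subrK.
Qed.

Lemma two_pi_i_neq0 : (2 * pi)%:C%C * 'i%C != 0 :> C.
Proof.
rewrite mulf_neq0 //; last by rewrite eq_complex /= oner_eq0 andbF.
by rewrite eq_complex /= eqxx andbT gt_eqF // pi2_gt0.
Qed.

(* The coefficients are Cauchy integrals of the sum. *)
Lemma laurent_sum_unique r u v F : (forall i, 0 < r 0 i) ->
  laurent_sum r u F -> laurent_sum r v F -> u =1 v.
Proof.
move=> r0 uF vF b.
pose K z := F z / monom b z / \prod_(i < D) z 0 i.
have := torus_integral_laurent (K := K) r0 (laurent_sum_shift b r0 uF) (fun _ _ => erefl).
rewrite (torus_integral_laurent (K := K) r0 (laurent_sum_shift b r0 vF) (fun _ _ => erefl)).
by rewrite !add0r => /mulfI ->//; rewrite expf_neq0 // two_pi_i_neq0.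
Qed.

(** Inversion replaces [u a] by [u (- a)], which fixes the constant coefficient; the two integrals
    are compared through it, without a change of variables. *)
Lemma torus_integral_inv r s u F G (K L : point -> C) :
  (forall i, 0 < r 0 i) -> (forall i, 0 < s 0 i) ->
  laurent_sum r u F -> laurent_sum (rinv s) u G ->
  (forall z, on_torus r z -> K z = F z / \prod_(i < D) z 0 i) ->
  (forall z, on_torus s z -> L z = G (zinv z) / \prod_(i < D) z 0 i) ->
  torus_integral r K = torus_integral s L.
Proof.
move=> r0 s0 uF /laurent_sum_inv; rewrite rinvK => uG KF LG.
by rewrite (torus_integral_laurent r0 uF KF) (torus_integral_laurent s0 uG LG) oppr0.
Qed.

End LaurentAlgebra.

(** * The complex exponential as an unordered power series *)

Section Exponential.
Variable R : realType.
Local Notation C := (Cplx R).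

Lemma cvg_complex (a b : nat -> R) (la lb : R) :
  (a @ \oo --> la)%classic -> (b @ \oo --> lb)%classic ->
  ((fun n => (a n +i* b n)%C : C) @ \oo --> ((la +i* lb)%C : C))%classic.
Proof.
move=> /cvgrPdist_lt al /cvgrPdist_lt bl; apply/cvgrPdist_lt => e e0.
have eE : e = (complex.Re e)%:C%C by rewrite RRe_real // gtr0_real.
move: e0; rewrite eE ltcR => e0.
have e20 : 0 < complex.Re e / 2 by rewrite divr_gt0.
move: (al _ e20) (bl _ e20); apply: filterS2 => n an bn.
have -> : ((la +i* lb)%C - (a n +i* b n)%C : C) = (la - a n)%:C%C + 'i%C * (lb - b n)%:C%C.
  by apply/eqP; rewrite eq_complex /= !mul0r !mul1r subr0 addr0 !add0r !eqxx.
apply: le_lt_trans (ler_normD _ _) _; rewrite normrM.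
have -> : `|'i%C : C| = 1 by rewrite normc_def /= expr0n /= add0r expr1n sqrtr1.
by rewrite mul1r !normc_real -rmorphD ltcR (splitr (complex.Re e)) ltrD.
Qed.

(** The bound is [e^|z|]. *)
Lemma exp_abs_bounded (z : C) :
  exists M, abs_bounded (fun k => (k`!%:R)^-1 * z ^+ k) M.
Proof.
have [m zm] : exists m : R, `|z| = m%:C%C by rewrite normc_def; eexists.
have m0 : 0 <= m by rewrite -ler0c -zm.
exists (expR m)%:C%C => s us.
have -> : \sum_(k <- s) `|(k`!%:R)^-1 * z ^+ k| = (\sum_(k <- s) exp_coeff m k)%:C%C.
  rewrite (rmorph_sum (real_complex R)); apply: eq_bigr => k _.
  rewrite normrM normfV normr_nat normrX zm /exp_coeff /= mulrC.
  by rewrite !(rmorphM, rmorphXn, fmorphV, rmorph_nat).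
rewrite lecR; pose n := (\max_(k <- s) k).+1.
apply: (@le_trans _ _ (series (exp_coeff m) n)).
  rewrite /series /= [leRHS](@big_uniq_sub _ _ _ s) ?iota_uniq //.
    by rewrite lerDl sumr_ge0 // => i _; exact: exp_coeff_ge0.
  by move=> k ks; rewrite mem_index_iota /= ltnS; exact: leq_bigmax_seq.
apply: nondecreasing_cvgn_le; last exact: is_cvg_series_exp_coeff.
by apply: nondecreasing_series => k _ _; exact: exp_coeff_ge0.
Qed.

Lemma exp_hsum_lim (z l : C) :
  ((fun n => \sum_(0 <= k < n) (k`!%:R)^-1 * z ^+ k) @ \oo --> l)%classic ->
  hsum (fun k => (k`!%:R)^-1 * z ^+ k) l.
Proof.
move=> zl; have [S hS] := abs_summable_hsum (exp_abs_bounded z).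
suff -> : l = S by [].
rewrite -(hsum_series hS); apply/esym/cvg_lim => //; exact: norm_hausdorff.
Qed.

Lemma exp_hsum_real (x : R) : hsum (fun k => (k`!%:R)^-1 * (x%:C%C : C) ^+ k) (expR x)%:C%C.
Proof.
apply: exp_hsum_lim.
rewrite (_ : (fun n => _) = (fun n => (series (exp_coeff x) n +i* 0)%C)).
  by apply: cvg_complex; [exact: is_cvg_series_exp_coeff|exact: cvg_cst].
apply/funext => n; rewrite /series /= -[RHS]/((_)%:C%C) (rmorph_sum (real_complex R)).
apply: eq_bigr => k _.
by rewrite mulrC !(rmorphM, rmorphXn, fmorphV, rmorph_nat).
Qed.

(** Written with [odd] and halves to match the coefficients of the real sine and cosine series. *)
Lemma expr_i (n : nat) : ('i%C : C) ^+ n =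
  ((~~ odd n)%:R * (-1) ^+ n./2 +i* ((odd n)%:R * (-1) ^+ n.-1./2))%C.
Proof.
have even_case h : ('i%C : C) ^+ h.*2 = ((-1) ^+ h)%:C%C.
  by rewrite -mul2n exprM sqr_i [RHS](rmorphXn (real_complex R)) rmorphN1.
have [h [b ->]] : exists h, exists b : bool, n = (b + h.*2)%N.
  by exists n./2, (odd n); rewrite odd_double_half.
case: b; last by rewrite add0n even_case odd_double mul1r mul0r doubleK.
rewrite add1n exprS even_case /= odd_double doubleK mul1r mul0r.
by apply/eqP; rewrite eq_complex /= !mul0r !mul1r subr0 add0r !eqxx.
Qed.

Lemma exp_hsum_imaginary (y : R) :
  hsum (fun k => (k`!%:R)^-1 * ('i%C * y%:C%C : C) ^+ k) (cis y).
Proof.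
apply: exp_hsum_lim.
rewrite (_ : (fun n => _) =
    (fun n => (series (cos_coeff y) n +i* series (sin_coeff y) n)%C)).
  rewrite /cis cos.unlock sin.unlock; apply: cvg_complex.
    exact: is_cvg_series_cos_coeff.
  exact: is_cvg_series_sin_coeff.
apply/funext => n; elim: n => [|n ih]; first by rewrite /series /= !big_geq.
rewrite big_nat_recr //= ih !seriesSr exprMn expr_i.
have -> : (y%:C%C : C) ^+ n = (y ^+ n)%:C%C by rewrite (rmorphXn (real_complex R)).
have -> : (n`!%:R : C)^-1 = (n`!%:R^-1)%:C%C by rewrite fmorphV rmorph_nat.
rewrite /cos_coeff /sin_coeff /=; apply/eqP; rewrite eq_complex /=.
by rewrite -!exprnP; apply/andP; split; apply/eqP; ring.
Qed.

(** [cexp] is defined by real and imaginary part; the product of the two series is regrouped by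
    total degree and the binomial theorem applied. *)
Lemma exp_hsum (z : C) : hsum (fun k => (k`!%:R)^-1 * z ^+ k) (cexp z).
Proof.
pose x : C := (complex.Re z)%:C%C; pose y : C := 'i%C * (complex.Im z)%:C%C.
have zE : z = x + y by rewrite [LHS]complexE.
pose e (w : C) k : C := (k`!%:R)^-1 * w ^+ k.
(* Terms of total degree [n], extended by zero to [k > n]. *)
pose v (nk : nat * nat) : C := if (nk.2 <= nk.1)%N then e x nk.2 * e y (nk.1 - nk.2)%N else 0.
apply: (@hsum_pair _ _ _ v) => [n|]; last first.
  apply: (@hsum_inj _ _ _ (fun kl : nat * nat => ((kl.1 + kl.2)%N, kl.1))).
  - by move=> [k l] [k' l'] /= [+ kk']; rewrite kk' => /addnI ->.
  - move=> [n k]; rewrite /v /=; case: leqP => [kn _|_]; last by rewrite eqxx.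
    by exists (k, (n - k)%N); rewrite /= subnKC.
  - rewrite /v; apply: eq_hsum (hsum_prod (exp_abs_bounded x) (exp_abs_bounded y)
      (exp_hsum_real _) (exp_hsum_imaginary _)) => -[k l] /=.
    by rewrite leq_addr addKn.
have -> : (n`!%:R)^-1 * z ^+ n = \sum_(k <- iota 0 n.+1) v (n, k).
  rewrite -/(index_iota 0 n.+1) big_mkord zE addrC exprDn mulr_sumr; apply: eq_bigr => k _.
  have kn : (k <= n)%N by rewrite -ltnS.
  rewrite /v /= kn /e -(bin_fact kn) !natrM -mulr_natr.
  have f0 m : m`!%:R != 0 :> C by rewrite pnatr_eq0 -lt0n fact_gt0.
  have b0 : 'C(n, k)%:R != 0 :> C by rewrite pnatr_eq0 -lt0n bin_gt0.
  by field; rewrite !f0 b0.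
apply: hsum_fin; first exact: iota_uniq.
move=> k; rewrite mem_iota add0n ltnS /v /= => /negPf ->.
by [].
Qed.

Lemma cexpN (z : C) : cexp (- z) * cexp z = 1.
Proof.
rewrite /cexp (_ : complex.Re (- z) = - complex.Re z); last by case: z.
rewrite (_ : complex.Im (- z) = - complex.Im z); last by case: z.
rewrite mulrACA -cisD addNr cis0 mulr1 -rmorphM -expRD addNr expR0.
by [].
Qed.

End Exponential.

(** * Semi-infinite matrices *)

Section Toeplitz.
Variables (R : realType) (D : nat).
Local Notation C := (Cplx R).
Local Notation idx := 'rV[int]_D.
Local Notation point := 'rV[C]_D.
Implicit Types (u v : idx -> C) (F G : point -> C) (r s : 'rV[R]_D) (z : point).

(** With this sign [chi z] is formally an eigenvector of [toep u], with eigenvalue the symbol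
    [u(z)]. *)
Definition toep u : smx R D := fun a b => u (b - a).

(** Coefficients of the conjugate of the symbol at the reflected point [1 / zbar]. *)
Definition coef_adj u : idx -> C := fun k => (u (- k))^*.

Lemma dagger_toep u : dagger (toep u) = toep (coef_adj u).
Proof. by apply/funext => a; apply/funext => b; rewrite /dagger /toep /coef_adj opprB. Qed.

Lemma smul_toep u v z : (forall i, z 0 i != 0) ->
  abs_summable (fun a => u a * monom a z) ->
  abs_summable (fun a => v a * monom a z) ->
  smul (toep u) (toep v) = toep (cauchy_prod u v).
Proof.
move=> z0 au av; apply/funext => a; apply/funext => b.
apply: hsum_zsum; apply: (@hsum_inj _ _ _ (fun k : idx => k + a)).
- exact: addIr.
- by move=> k _; exists (k - a); rewrite subrK.
apply: eq_hsum (zsumP (cauchy_summable (b - a) z0 au av)) => k.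
by rewrite /toep addrK [k + a]addrC opprD addrA.
Qed.

Definition coef1 : idx -> C := fun a => (a == 0)%:R.

Lemma coef1_fin a z : a != 0 -> coef1 a * monom a z = 0.
Proof. by rewrite /coef1 => /negPf ->; rewrite mul0r. Qed.

Lemma coef1_abs_bounded z : abs_bounded (fun a => coef1 a * monom a z) 1.
Proof.
move=> s us; have [s0|s0] := boolP (0 \in s).
  rewrite (bigD1_seq 0) //= big1 ?addr0 => [|a a0]; last by rewrite coef1_fin ?normr0.
  by rewrite /coef1 eqxx monom0 mulr1 normr1.
rewrite big1_seq // => a /= as_; rewrite coef1_fin ?normr0 //.
by apply: contraNneq s0 => <-.
Qed.

Lemma coef1_hsum z : hsum (fun a => coef1 a * monom a z) 1.
Proof.
have -> : 1 = \sum_(a <- [:: 0]) coef1 a * monom a z.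
  by rewrite big_seq1 /coef1 eqxx monom0 mulr1.
by apply: hsum_fin => // a; rewrite inE; exact: coef1_fin.
Qed.

Lemma toep_coef1 : toep coef1 = @smx1 R D.
Proof.
by apply/funext => a; apply/funext => b; rewrite /toep /coef1 /smx1 subr_eq0 eq_sym.
Qed.

Definition cpow u n : idx -> C := iter n (cauchy_prod u) coef1.

Lemma cpow_abs_bounded u z M n : (forall i, z 0 i != 0) ->
  abs_bounded (fun a => u a * monom a z) M ->
  abs_bounded (fun a => cpow u n a * monom a z) (M ^+ n).
Proof.
move=> z0 uM; elim: n => [|n ih]; first exact: coef1_abs_bounded.
by rewrite exprS; exact: cauchy_abs_bounded.
Qed.

Lemma cpow_hsum u z U n : (forall i, z 0 i != 0) ->
  abs_summable (fun a => u a * monom a z) -> hsum (fun a => u a * monom a z) U ->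
  hsum (fun a => cpow u n a * monom a z) (U ^+ n).
Proof.
move=> z0 au hu; elim: n => [|n ih]; first exact: coef1_hsum.
rewrite exprS; apply: cauchy_hsum => //.
by case: au => M uM; exists (M ^+ n); exact: cpow_abs_bounded.
Qed.

Lemma spow_toep u z n : (forall i, z 0 i != 0) ->
  abs_summable (fun a => u a * monom a z) -> spow (toep u) n = toep (cpow u n).
Proof.
move=> z0 au; elim: n => [|n ih]; first by rewrite /spow /= toep_coef1.
rewrite /spow iterS -/(spow _ n) ih (smul_toep z0 au) //.
by case: au => M uM; exists (M ^+ n); exact: cpow_abs_bounded.
Qed.

(** Laurent coefficients of [e^u], summed over the power [k] at fixed exponent, hence independent of
    any point [z]. *)
Definition exp_coef u : idx -> C :=
  fun a => usum (fun k => (k`!%:R)^-1 * cpow u k a).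

Section ExpFamily.
Variables (u : idx -> C) (z : point) (U : C).
Hypotheses (z0 : forall i, z 0 i != 0)
  (au : abs_summable (fun a => u a * monom a z))
  (hu : hsum (fun a => u a * monom a z) U).

(** Its rows sum to [U^k / k!] and its columns to the terms of the Laurent series of [e^u];
    exchanging the two sums gives [exp_coef_laurent]. *)
Let family (ka : nat * idx) : C := (ka.1`!%:R)^-1 * (cpow u ka.1 ka.2 * monom ka.2 z).

Let family_summable : abs_summable family.
Proof.
have [M uM] := au; have [N hN] := exp_abs_bounded M.
exists N; apply: (@abs_bounded_pair _ _ _ _ (fun k => `|(k`!%:R)^-1| * M ^+ k)) => [k|].
  by apply: abs_boundedZ; exact: cpow_abs_bounded.
by apply: abs_bounded_le hN => k; rewrite !normrM normr_id.
Qed.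

Let family_row k : hsum (fun a => family (k, a)) ((k`!%:R)^-1 * U ^+ k).
Proof. by apply: hsumZ; exact: cpow_hsum. Qed.

Let col_summable a : abs_summable (fun k => (k`!%:R)^-1 * cpow u k a).
Proof.
have h := abs_summable_comp (g := fun k => (k, a)) (fun _ _ e => congr1 fst e) family_summable.
apply: abs_summable_le (abs_summableZ (monom a z)^-1 h) => k.
by rewrite /family /= [(monom a z)^-1 * _]mulrC mulrA mulfK // monom_neq0.
Qed.

Lemma exp_coef_hsum a : hsum (fun k => (k`!%:R)^-1 * cpow u k a) (exp_coef u a).
Proof. exact/usumP/col_summable. Qed.

Let family_col a : hsum (fun k => family (k, a)) (exp_coef u a * monom a z).
Proof.
rewrite mulrC; apply: eq_hsum (hsumZ (monom a z) (exp_coef_hsum a)) => k.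
by rewrite /family /= mulrC mulrA.
Qed.

Lemma exp_coef_laurent :
  abs_summable (fun a => exp_coef u a * monom a z) /\
  hsum (fun a => exp_coef u a * monom a z) (cexp U).
Proof.
split; last exact: hsum_exchange family_summable family_row family_col (exp_hsum U).
have [M fM] := family_summable; exists M.
apply: (@abs_bounded_rowsum _ _ _ (fun x => family (x.2, x.1))) family_col _.
apply: (@abs_bounded_inj _ _ _ (fun x : nat * idx => (x.2, x.1))).
- by move=> [? ?] [? ?] [-> ->].
- by move=> [a k] _; exists (k, a).
- by move: fM; congr abs_bounded; apply/funext => -[].
Qed.

Lemma W0_toep : W0 u = toep (exp_coef u).
Proof.
have E : (fun b g => zsum (fun a => u a * @Upsilon R D a b g)) = toep u.
  apply/funext => b; apply/funext => g.
  rewrite (@zsum1 _ _ (g - b)) /Upsilon.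
    by rewrite [b + _]addrC subrK eqxx mulr1.
  move=> a ab; rewrite (_ : (b + a == g) = false) ?mulr0 //.
  by apply: contraNF ab => /eqP <-; rewrite addrAC subrr add0r.
rewrite /W0 E /sexp; apply/funext => a; apply/funext => b.
rewrite [RHS]/toep -(hsum_series (exp_coef_hsum (b - a))).
congr (limn _); apply/funext => n; apply: eq_bigr => k _.
by rewrite (spow_toep _ z0 au).
Qed.

End ExpFamily.

End Toeplitz.

(** * Block triangular matrices: associativity and inverses *)

Section Triangular.
Variables (R : realType) (D : nat).
Local Notation C := (Cplx R).
Local Notation idx := 'rV[int]_D.
Local Notation point := 'rV[C]_D.
Local Notation mx := (smx R D).
Implicit Types (A B E : mx) (a b k l : idx).

Definition block_lower A := forall a b, (length1 a < length1 b)%N -> A a b = 0.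
Definition block_upper A := forall a b, (length1 b < length1 a)%N -> A a b = 0.

Lemma block_lower_dagger A : block_upper A -> block_lower (dagger A).
Proof. by move=> Au a b ab; rewrite /dagger Au // conjC0. Qed.

Lemma block_upper_dagger A : block_lower A -> block_upper (dagger A).
Proof. by move=> Al a b ab; rewrite /dagger Al // conjC0. Qed.

Lemma daggerK A : dagger (dagger A) = A.
Proof. by apply/funext => a; apply/funext => b; rewrite /dagger conjCK. Qed.

Lemma block_diagonal_lower A : block_diagonal A -> block_lower A.
Proof. by move=> Ad a b ab; apply: Ad; rewrite neq_ltn ab. Qed.

Lemma block_diagonal_upper A : block_diagonal A -> block_upper A.
Proof. by move=> Ad a b ab; apply: Ad; rewrite neq_ltn ab orbT. Qed.

Lemma block_diagonal_dagger A : block_diagonal A -> block_diagonal (dagger A).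
Proof. by move=> Ad a b ab; rewrite /dagger Ad ?conjC0 // eq_sym. Qed.

Lemma unitriangular_lower A : block_lower_unitriangular A -> block_lower A.
Proof.
move=> Au a b ab; rewrite Au ?(ltnW ab) //; case: eqP ab => // ->.
by rewrite ltnn.
Qed.

Lemma notin_ball_seq n a : a \notin ball_seq D n -> (n < length1 a)%N.
Proof. by rewrite mem_ball_seq -ltnNge. Qed.

Lemma summable_lower A (x : idx -> C) a : block_lower A ->
  abs_summable (fun k => A a k * x k).
Proof.
move=> Al; apply: (abs_summable_fin (ball_seq_uniq D (length1 a))) => k.
by move=> /notin_ball_seq ak; rewrite Al // mul0r.
Qed.

Lemma summable_upper B (x : idx -> C) b : block_upper B ->
  abs_summable (fun k => x k * B k b).
Proof.
move=> Bu; apply: (abs_summable_fin (ball_seq_uniq D (length1 b))) => k.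
by move=> /notin_ball_seq bk; rewrite Bu // mulr0.
Qed.

Lemma smul_lower A B : block_lower A -> block_lower B -> block_lower (smul A B).
Proof.
move=> Al Bl a b ab; rewrite /smul (@zsum1 _ _ a); first by rewrite Bl ?mulr0.
move=> k _; case: (ltnP (length1 a) (length1 k)) => ak; first by rewrite Al ?mul0r.
by rewrite Bl ?mulr0 // (leq_ltn_trans ak).
Qed.

Lemma smul_upper A B : block_upper A -> block_upper B -> block_upper (smul A B).
Proof.
move=> Au Bu a b ab; rewrite /smul (@zsum1 _ _ b); first by rewrite Au ?mul0r.
move=> k _; case: (ltnP (length1 b) (length1 k)) => bk; first by rewrite Bu ?mulr0.
by rewrite Au ?mul0r // (leq_ltn_trans bk).
Qed.

Lemma smul_assoc_fin A B E a b m n :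
  (forall k l, (m < length1 k)%N \/ (n < length1 l)%N -> A a k * B k l * E l b = 0) ->
  smul (smul A B) E a b = smul A (smul B E) a b.
Proof.
move=> h; apply: zsum_assoc.
have up : uniq (allpairs pair (ball_seq D m) (ball_seq D n)).
  by apply: allpairs_uniq; rewrite ?ball_seq_uniq // => -[? ?] [? ?] _ _ [-> ->].
apply: (abs_summable_fin up) => -[k l] kl /=; apply: h.
case: (ltnP m (length1 k)) => [|km]; first by left.
case: (ltnP n (length1 l)) => [|ln]; first by right.
by move: kl; rewrite (allpairs_f pair) // mem_ball_seq.
Qed.

(** Row [a] of [A] stops at length [length1 a], and so do the rows of [B] that it meets; [E] is
    arbitrary. *)
Lemma smulA_lower A B E : block_lower A -> block_lower B ->
  smul (smul A B) E = smul A (smul B E).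
Proof.
move=> Al Bl; apply/funext => a; apply/funext => b.
apply: (@smul_assoc_fin _ _ _ _ _ (length1 a) (length1 a)) => k l [ak|al].
  by rewrite Al ?mul0r.
case: (ltnP (length1 a) (length1 k)) => ak; first by rewrite Al ?mul0r.
by rewrite Bl ?mulr0 ?mul0r // (leq_ltn_trans ak).
Qed.

Lemma smulA_upper A B E : block_upper B -> block_upper E ->
  smul (smul A B) E = smul A (smul B E).
Proof.
move=> Bu Eu; apply/funext => a; apply/funext => b.
apply: (@smul_assoc_fin _ _ _ _ _ (length1 b) (length1 b)) => k l [bk|bl].
  case: (ltnP (length1 b) (length1 l)) => bl; first by rewrite Eu ?mulr0.
  by rewrite Bu ?mulr0 ?mul0r // (leq_ltn_trans bl).
by rewrite Eu ?mulr0.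
Qed.

(** Each of the two sums is truncated by an outer factor, so the middle one may be full. *)
Lemma smulA_mid A B E : block_lower A -> block_upper E ->
  smul (smul A B) E = smul A (smul B E).
Proof.
move=> Al Eu; apply/funext => a; apply/funext => b.
apply: (@smul_assoc_fin _ _ _ _ _ (length1 a) (length1 b)) => k l [ak|bl].
  by rewrite Al ?mul0r.
by rewrite Eu ?mulr0.
Qed.

Lemma smul1l A : smul (@smx1 R D) A = A.
Proof.
apply/funext => a; apply/funext => b; rewrite /smul (@zsum1 _ _ a) /smx1.
  by rewrite eqxx mul1r.
by move=> k; rewrite eq_sym => /negPf ->; rewrite mul0r.
Qed.

Lemma smul1r A : smul A (@smx1 R D) = A.
Proof.
apply/funext => a; apply/funext => b; rewrite /smul (@zsum1 _ _ b) /smx1.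
  by rewrite eqxx mulr1.
by move=> k /negPf ->; rewrite mulr0.
Qed.

Lemma dagger1 : dagger (@smx1 R D) = @smx1 R D.
Proof.
by apply/funext => a; apply/funext => b; rewrite /dagger /smx1 conjC_nat eq_sym.
Qed.

Lemma dagger_smul_lower A B : block_lower A ->
  dagger (smul A B) = smul (dagger B) (dagger A).
Proof.
move=> Al; apply/funext => a; apply/funext => b.
rewrite /dagger /smul -zsum_conj; last exact: summable_lower.
by congr zsum; apply/funext => k; rewrite rmorphM mulrC.
Qed.

Lemma dagger_smul_upper A B : block_upper B ->
  dagger (smul A B) = smul (dagger B) (dagger A).
Proof.
move=> Bu; apply/funext => a; apply/funext => b.
rewrite /dagger /smul -zsum_conj; last exact: summable_upper.
by congr zsum; apply/funext => k; rewrite rmorphM mulrC.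
Qed.

(** [sinv] chooses among all inverses, triangular or not; a lower one equals any competitor [B']
    because [(B A) B' = B (A B')] holds for arbitrary [B']. *)
Lemma sinv_lower A B : block_lower A -> block_lower B -> smx_inverse A B ->
  sinv A = B.
Proof.
move=> Al Bl [AB BA]; apply: xget_unique => // B' [AB' _].
by rewrite -[LHS]smul1l -BA smulA_lower // AB' smul1r.
Qed.

Lemma sinv_upper A B : block_upper A -> block_upper B -> smx_inverse A B ->
  sinv A = B.
Proof.
move=> Au Bu [AB BA]; apply: xget_unique => // B' [_ BA'].
by rewrite -[LHS]smul1r -AB -smulA_upper // BA' smul1l.
Qed.

(* Forward substitution; the fuel [n] is irrelevant beyond [length1 a]. *)
Fixpoint lower_inv A (n : nat) a b : C :=
  if n is m.+1 then
    (a == b)%:R - \sum_(k <- ball_seq D (length1 a) | (length1 k < length1 a)%N)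
                     A a k * lower_inv A m k b
  else (a == b)%:R.

Lemma lower_inv_unitriangular A n : block_lower_unitriangular (lower_inv A n).
Proof.
elim: n => [|n ih] a b ab //=; rewrite big1 ?subr0 // => k ka.
rewrite ih ?(ltnW (leq_trans ka ab)) //; case: eqP => [kb|_]; rewrite ?mulr0 //.
by move: (leq_trans ka ab); rewrite kb ltnn.
Qed.

Lemma lower_inv_stable A m n a b : (length1 a < m)%N -> (length1 a < n)%N ->
  lower_inv A m a b = lower_inv A n a b.
Proof.
elim: m n a => [|m ih] [|n] a //= am an; congr (_ - _).
apply: eq_bigr => k ka; congr (_ * _).
by apply: ih; [rewrite (leq_trans ka)|rewrite (leq_trans ka)].
Qed.

Lemma lower_right_inverse A : block_lower_unitriangular A ->
  exists2 B, block_lower_unitriangular B & smul A B = @smx1 R D.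
Proof.
move=> Au; have Al := unitriangular_lower Au.
exists (fun a b => lower_inv A (length1 a).+1 a b).
  by move=> a b; exact: lower_inv_unitriangular.
apply/funext => a; apply/funext => b; rewrite /smul.
rewrite (zsum_fin (ball_seq_uniq D (length1 a))); last first.
  by move=> k /notin_ball_seq ak; rewrite Al // mul0r.
rewrite (bigID (fun k => (length1 k < length1 a)%N)) /=.
set X := (X in _ + X = _).
have -> : X = lower_inv A (length1 a).+1 a b.
  rewrite /X -big_filter (bigD1_seq a) /=; first last.
  - by rewrite filter_uniq // ball_seq_uniq.
  - by rewrite mem_filter ltnn mem_ball_seq /=.
  rewrite [X in _ + X]big1_seq ?addr0 => [|k].
    by rewrite Au // eqxx mul1r.
  rewrite mem_filter -leqNgt => /and3P[ka ak _].
  by rewrite Au // eq_sym (negPf ka) mul0r.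
rewrite /= addrC -addrA [X in _ + X](_ : _ = 0) ?addr0 //.
rewrite addrC; apply/eqP; rewrite subr_eq0; apply/eqP.
apply: eq_bigr => k ka; congr (_ * _).
by apply: (@lower_inv_stable A (length1 k).+1 (length1 a)).
Qed.

(** As in a monoid, a right inverse that has a right inverse is two-sided; the brackets move because
    [A] and [B] are lower. *)
Lemma unitriangular_inverse A : block_lower_unitriangular A ->
  exists2 B, block_lower_unitriangular B & smx_inverse A B.
Proof.
move=> Au; have [B Bu AB] := lower_right_inverse Au; exists B => //; split=> //.
have [E _ BE] := lower_right_inverse Bu.
have lowA := unitriangular_lower Au; have lowB := unitriangular_lower Bu.
by rewrite -[A in smul B A]smul1r -BE -[smul A _]smulA_lower // AB smul1l BE.
Qed.

End Triangular.

(** * Consequences of the Gauss-Borel factorization *)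

Section GaussBorel.
Variables (R : realType) (D : nat).
Local Notation C := (Cplx R).
Local Notation mx := (smx R D).
Implicit Types (G S H T K : mx).

(* Consequences of [G = S^-1 H T^-dagger], with [N = T^dagger H^-1]. *)
Record factorization G S H T (N : mx) : Prop := Factorization {
  fact_S : block_lower S;
  fact_T : block_lower T;
  fact_N : block_upper N;
  fact_SG : smul H (dagger (sinv T)) = smul S G;
  fact_GN : sinv S = smul G N;
  fact_sinv : sinv (smul H (dagger (sinv T))) = N }.

Lemma sinv_unitriangular S : block_lower_unitriangular S ->
  block_lower_unitriangular (sinv S) /\ smx_inverse S (sinv S).
Proof.
move=> Su; have [B Bu SB] := unitriangular_inverse Su.
by rewrite (sinv_lower (unitriangular_lower Su) (unitriangular_lower Bu) SB).
Qed.

Lemma smx_inverse_dagger_lower S T : block_lower S -> block_lower T ->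
  smx_inverse S T -> smx_inverse (dagger S) (dagger T).
Proof.
move=> Sl Tl [ST TS]; split; first by rewrite -dagger_smul_lower // TS dagger1.
by rewrite -dagger_smul_lower // ST dagger1.
Qed.

Lemma gauss_borel_factorization G S H T : gauss_borel G S H T ->
  exists N, factorization G S H T N.
Proof.
move=> [Su Tu Hd [K Kd [HK KH]] GE].
have [Siu [SSi SiS]] := sinv_unitriangular Su.
have [Tiu TTi] := sinv_unitriangular Tu.
have Sl := unitriangular_lower Su; have Sil := unitriangular_lower Siu.
have Tl := unitriangular_lower Tu; have Til := unitriangular_lower Tiu.
have [TdTid TidTd] := smx_inverse_dagger_lower Tl Til TTi.
have Td := block_upper_dagger Tl; have Tid := block_upper_dagger Til.
have Hl := block_diagonal_lower Hd; have Hu := block_diagonal_upper Hd.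
have Kl := block_diagonal_lower Kd; have Ku := block_diagonal_upper Kd.
have Nu : block_upper (smul (dagger T) K) by exact: smul_upper.
exists (smul (dagger T) K); split=> //.
- rewrite GE smulA_lower //  -[in RHS]smulA_lower // SSi smul1l //.
(* [G] may be full: the brackets move thanks to the lower factor [S^-1 H] on its left and the upper
   [N] on the right. *)
- rewrite GE smulA_mid //; last exact: smul_lower.
  rewrite -[smul (dagger (sinv T)) _]smulA_upper // TidTd smul1l.
  by rewrite smulA_lower // HK smul1r.
- apply: sinv_upper => //; first exact: smul_upper.
  split.
    rewrite smulA_upper // -[smul (dagger (sinv T)) _]smulA_upper //.
    by rewrite TidTd smul1l.
  rewrite smulA_upper //; last exact: smul_upper.
  by rewrite -[smul K _]smulA_upper // KH smul1l.
Qed.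

(** Lets every fact about one family of wave matrices be reused for the other one. *)
Lemma gauss_borel_dagger G S H T :
  gauss_borel G S H T -> gauss_borel (dagger G) T (dagger H) S.
Proof.
move=> [Su Tu Hd [K Kd [HK KH]] GE].
have [/unitriangular_lower Sil _] := sinv_unitriangular Su.
have [/unitriangular_lower Til _] := sinv_unitriangular Tu.
have Hl := block_diagonal_lower Hd; have Kl := block_diagonal_lower Kd.
split=> //; first exact: block_diagonal_dagger.
  exists (dagger K); first exact: block_diagonal_dagger.
  exact: smx_inverse_dagger_lower.
rewrite GE dagger_smul_lower; last exact: smul_lower.
rewrite daggerK dagger_smul_lower // smulA_upper //; last exact: block_upper_dagger.
exact/block_diagonal_upper/block_diagonal_dagger.
Qed.

End GaussBorel.

(** * Toeplitz matrices acting on monomials, and Laurent series on several tori *)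

Section Symbols.
Variables (R : realType) (D : nat).
Local Notation C := (Cplx R).
Local Notation idx := 'rV[int]_D.
Local Notation point := 'rV[C]_D.
Local Notation mx := (smx R D).
Implicit Types (u v : idx -> C) (P Q N : mx) (r s : 'rV[R]_D) (z : point).

(** The eigenvector property of [chi z]; the rows of [P] are finite, so the double sum is absolutely
    convergent. *)
Lemma sapp_toep P u z a : block_lower P -> (forall i, z 0 i != 0) ->
  abs_summable (fun k => u k * monom k z) ->
  sapp (smul P (toep u)) (chi z) a = sapp P (chi z) a * laurent u z.
Proof.
move=> Pl z0 au.
have reindex k : hsum (fun l => toep u k l * monom l z) (monom k z * laurent u z).
  apply: (@hsum_inj _ _ _ (fun m : idx => m + k)); first exact: addIr.
    by move=> l _; exists (l - k); rewrite subrK.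
  apply: eq_hsum (hsumZ (monom k z) (zsumP au)) => m.
  by rewrite /toep addrK monomD // mulrC -mulrA.
rewrite /sapp /smul zsum_assoc /=.
  transitivity (zsum (fun k => laurent u z * (P a k * chi z k))).
    congr zsum; apply/funext => k; rewrite (hsum_zsum (reindex k)) /chi.
    by rewrite mulrA mulrC.
  rewrite zsumZ; first by rewrite mulrC.
  exact: summable_lower.
apply: (abs_summable_finl (ball_seq_uniq D (length1 a))) => [k l|k] /=.
  by move=> /notin_ball_seq ak; rewrite Pl // !mul0r.
apply: (@abs_summable_inj _ _ _ (fun m : idx => m + k)); first exact: addIr.
  by move=> l _; exists (l - k); rewrite subrK.
apply: abs_summable_le (abs_summableZ (P a k * monom k z) au) => m.
rewrite /toep addrK /chi monomD //.
by rewrite -!mulrA [monom m z * _]mulrC [monom k z * _]mulrCA.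
Qed.

(** Columns of [N] are finite, and for each of their entries the remaining sum is a convolution
    converging absolutely. *)
Lemma smul_toepA u v N z : (forall i, z 0 i != 0) -> block_upper N ->
  abs_summable (fun a => u a * monom a z) ->
  abs_summable (fun a => v a * monom a z) ->
  smul (toep u) (smul (toep v) N) = smul (smul (toep u) (toep v)) N.
Proof.
move=> z0 Nu au av; apply/funext => a; apply/funext => b.
apply/esym/zsum_assoc => /=.
apply: (abs_summable_finr (ball_seq_uniq D (length1 b))) => [k l|l] /=.
  by move=> /notin_ball_seq bl; rewrite Nu // mulr0.
apply: (@abs_summable_inj _ _ _ (fun k : idx => k + a)); first exact: addIr.
  by move=> k _; exists (k - a); rewrite subrK.
apply: abs_summable_le (abs_summableZ (N l b) (cauchy_summable (l - a) z0 au av)) => k.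
by rewrite /toep addrK mulrC [k + a]addrC opprD addrA.
Qed.

Lemma on_torus_real r : (forall i, 0 < r 0 i) ->
  on_torus r (\row_i ((r 0 i)%:C%C : C)).
Proof. by move=> r0 i; rewrite mxE normc_real gtr0_norm. Qed.

Lemma rinv_gt0 r : (forall i, 0 < r 0 i) -> forall i, 0 < (rinv r) 0 i.
Proof. by move=> r0 i; rewrite mxE invr_gt0. Qed.

Lemma zinv_zbarK z : zinv (zbar (zinv (zbar z))) = z.
Proof. by rewrite zbar_inv zinvK zbarK. Qed.

Lemma laurent_sum_sapp P r a : block_lower P ->
  laurent_sum r (P a) (fun z => sapp P (chi z) a).
Proof.
move=> Pl z _; have Ps := @summable_lower _ _ P (fun k => monom k z) a Pl.
by split=> //; exact: zsumP.
Qed.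

(** The order of the quantifiers matters: one family [u] serves for all radii in [A], which is what
    makes two tori comparable. *)
Definition laurent_on (A : set 'rV[R]_D) (F : point -> C) : Prop :=
  exists u, forall r, A r -> (forall i, 0 < r 0 i) /\ laurent_sum r u F.

Variable A : set 'rV[R]_D.

Lemma laurent_onM (F G : point -> C) : laurent_on A F -> laurent_on A G ->
  laurent_on A (fun z => F z * G z).
Proof.
move=> [u uF] [v vG]; exists (cauchy_prod u v) => r Ar.
have [r0 ur] := uF r Ar; have [_ vr] := vG r Ar.
by split=> //; exact: laurent_sumM.
Qed.

Lemma laurent_on_conj (F : point -> C) : laurent_on A F ->
  laurent_on A (fun z => (F (zbar z))^*).
Proof.
move=> [u uF]; exists (coef_conj u) => r /uF[r0 ur].
by split=> //; exact: laurent_sum_conj.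
Qed.

Hypothesis A_gt0 : forall r, A r -> forall i, 0 < r 0 i.

Lemma laurent_on_sapp P a : block_lower P ->
  laurent_on A (fun z => sapp P (chi z) a).
Proof. by move=> Pl; exists (P a) => r /A_gt0 r0; split=> //; exact: laurent_sum_sapp. Qed.

Lemma laurent_on_sapp_inv P a : block_lower P ->
  laurent_on A (fun z => sapp P (chi (zinv z)) a).
Proof.
move=> Pl; exists (fun k => P a (- k)) => r /A_gt0 r0; split=> //.
have := laurent_sum_inv (@laurent_sum_sapp P (rinv r) a Pl).
by rewrite rinvK.
Qed.

End Symbols.

(** * Baker functions *)

Section Domains.
Variables (R : realType) (D : nat).
Local Notation C := (Cplx R).
Local Notation idx := 'rV[int]_D.
Local Notation point := 'rV[C]_D.
Implicit Types (u : idx -> C) (z c : point).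

Lemma laurent_summable_abs u z : laurent_summable u z ->
  abs_summable (fun a => u a * monom a z).
Proof.
move=> us; pose f (a : idx) : R := Normc.normc (u a * monom a z).
have fin : (\esum_(x in [set: idx]) `|(f x)%:E|)%E \is a fin_num by rewrite -summableE.
exists (fine (\esum_(x in [set: idx]) `|(f x)%:E|)%E)%:C%C => s us'.
have -> : \sum_(a <- s) `|u a * monom a z| = (\sum_(a <- s) f a)%:C%C.
  by rewrite (rmorph_sum (real_complex R)); apply: eq_bigr.
rewrite lecR -lee_fin fineK //; apply: esum_ge.
exists [set` s]%classic; first by split => //; exact: finite_seq.
rewrite -fsbig_seq // -sumEFin; apply: lee_sum => a _.
exact: lee_abs.
Qed.

Lemma norm_monom u z c a : on_torus (polyradius c) z ->
  `|u a * monom a z| = `|u a * monom a c|.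
Proof.
move=> zc; rewrite !normrM /monom !normr_prod; congr (_ * _).
by apply: eq_bigr => i _; rewrite !normrXz zc mxE.
Qed.

Lemma laurent_sum_polyradius u c : laurent_summable u c ->
  laurent_sum (polyradius c) u (laurent u).
Proof.
move=> /laurent_summable_abs us z zc.
suff au : abs_summable (fun a => u a * monom a z) by split=> //; exact: zsumP.
by apply: abs_summable_le us => a; rewrite (norm_monom _ _ zc).
Qed.

Lemma polyradius_gt0 c : (forall i, c 0 i != 0) -> forall i, 0 < (polyradius c) 0 i.
Proof.
by move=> c0 i; rewrite mxE -ltcR; have := normr_gt0 (c 0 i); rewrite c0.
Qed.

End Domains.

(** * Symbols of the wave matrices and the resulting Baker functions *)

Section MomentMatrix.
Variables (R : realType) (D : nat).
Local Notation C := (Cplx R).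
Local Notation idx := 'rV[int]_D.
Variable mu : complex_measure R (torus_angles R D).

Definition moment_coef : idx -> C := fun a => ((2 * pi) ^+ D)%:C%C * fourier mu a.

Lemma cis_sum (I : Type) (s : seq I) (f : I -> R) :
  cis (\sum_(i <- s) f i) = \prod_(i <- s) cis (f i).
Proof. exact: (big_morph _ (@cisD R) (@cis0 R)). Qed.

Lemma monom_torus_point (a : idx) (theta : torus_angles R D) :
  monom a (torus_point theta) = cis (\sum_(i < D) (a 0 i)%:~R * (tnth theta i : R)).
Proof. by rewrite cis_sum; apply: eq_bigr => i _; rewrite mxE cisMz. Qed.

(** Entry [(a, b)] integrates [e^(i (a - b) theta)]: the Fourier coefficient of index [b - a] before
    normalisation by [(2 pi)^D]. *)
Lemma moment_matrix_toep : moment_matrix mu = toep moment_coef.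
Proof.
apply/funext => a; apply/funext => b.
rewrite /toep /moment_coef /fourier mulrA -rmorphM divff ?mul1r; last first.
  by rewrite expf_neq0 // gt_eqF // pi2_gt0.
rewrite /moment_matrix; congr (cm_integral _ _ _); apply/funext => theta.
rewrite /outer /chi !monom_torus_point conj_cis -cisD; congr cis.
rewrite -!sumrN -big_split /=; apply: eq_bigr => i _.
by rewrite !mxE rmorphB /=; ring.
Qed.

Lemma laurent_sum_moment r F : laurent_sum r (fourier mu) F ->
  laurent_sum r moment_coef (fun z => ((2 * pi) ^+ D)%:C%C * F z).
Proof. exact: laurent_sumZ. Qed.

Variable t : idx -> C.

Local Notation e := (exp_coef t).
Local Notation m := moment_coef.
Local Notation E z := (cexp (laurent t z)).
Local Notation M z := (((2 * pi) ^+ D)%:C%C * mu_hat mu z).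
Local Notation g := (cauchy_prod e m).

Definition convergent_at (r : 'rV[R]_D) : Prop :=
  [/\ forall i, 0 < r 0 i, laurent_sum r t (laurent t) &
      laurent_sum r (fourier mu) (mu_hat mu)].

Section AtRadius.
Variable r : 'rV[R]_D.
Hypothesis r_cvg : convergent_at r.

Let r0 : forall i, 0 < r 0 i. Proof. by case: r_cvg. Qed.

Lemma exp_neq0 z : E z != 0.
Proof.
apply/eqP => h; have := cexpN (laurent t z); rewrite h mulr0 => /eqP.
by rewrite eq_sym oner_eq0.
Qed.

Lemma laurent_sum_exp : laurent_sum r e (fun z => E z).
Proof.
have [_ tr _] := r_cvg => z zr; have [at_ ht] := tr _ zr.
exact: (exp_coef_laurent (fun i => on_torus_neq0 i r0 zr) at_ ht).
Qed.

Lemma laurent_sum_expN :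
  laurent_sum r (exp_coef (fun a => - t a)) (fun z => (E z)^-1).
Proof.
have [_ tr _] := r_cvg => z zr; have [at_ ht] := tr _ zr.
have z0 i := on_torus_neq0 i r0 zr.
have -> : (E z)^-1 = cexp (- laurent t z).
  by apply: (mulIf (exp_neq0 z)); rewrite mulVf ?exp_neq0 // cexpN.
have Ef : (fun a => - t a * monom a z) = (fun a => -1 * (t a * monom a z)).
  by apply/funext => a; rewrite mulN1r mulNr.
apply: exp_coef_laurent => //; rewrite Ef; first exact: abs_summableZ.
by have := hsumZ (-1) ht; rewrite mulN1r.
Qed.

Lemma W0E : W0 t = toep e.
Proof.
have [_ tr _] := r_cvg; have [at_ _] := tr _ (on_torus_real r0).
by apply: W0_toep at_ => i; exact: on_torus_neq0 (on_torus_real r0).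
Qed.

Lemma W0invE : W0inv t = toep (exp_coef (fun a => - t a)).
Proof.
have [_ tr _] := r_cvg; have [at_ _] := tr _ (on_torus_real r0).
have Ef z : (fun a => - t a * monom a z) = (fun a => -1 * (t a * monom a z)).
  by apply/funext => a; rewrite mulN1r mulNr.
apply: (@W0_toep _ _ _ (\row_i ((r 0 i)%:C%C : C))).
  by move=> i; exact: on_torus_neq0 (on_torus_real r0).
by rewrite Ef; exact: abs_summableZ.
Qed.

Lemma laurent_sum_m : laurent_sum r m (fun z => M z).
Proof. by have [_ _ mr] := r_cvg; exact: laurent_sum_moment. Qed.

Lemma laurent_sum_g : laurent_sum r g (fun z => E z * M z).
Proof. exact: laurent_sumM laurent_sum_exp laurent_sum_m. Qed.

Lemma moment_matrix_atE : moment_matrix_at mu t = toep g.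
Proof.
rewrite /moment_matrix_at moment_matrix_toep W0E.
have [ae _] := laurent_sum_exp (on_torus_real r0).
have [am _] := laurent_sum_m (on_torus_real r0).
by apply: smul_toep ae am => i; exact: on_torus_neq0 (on_torus_real r0).
Qed.

(** Both sides are Laurent coefficients of the same function, since [e^-t e^t M = M] on the
    torus. *)
Lemma expN_g : cauchy_prod (exp_coef (fun a => - t a)) g = m.
Proof.
apply/funext/(laurent_sum_unique r0 _ laurent_sum_m).
apply: laurent_sum_ext (laurent_sumM r0 laurent_sum_expN laurent_sum_g) => z _.
by rewrite mulKf // exp_neq0.
Qed.

Lemma laurent_sum_adjoint u F : laurent_sum r u F ->
  laurent_sum (rinv r) (coef_adj u) (fun z => (F (zinv (zbar z)))^*).
Proof. by move=> /laurent_sum_inv /laurent_sum_conj. Qed.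

Lemma expN_g_adj :
  cauchy_prod (coef_adj (exp_coef (fun a => - t a))) (coef_adj g) = coef_adj m.
Proof.
have s0 := rinv_gt0 r0.
apply/funext/(laurent_sum_unique s0 _ (laurent_sum_adjoint laurent_sum_m)).
apply: laurent_sum_ext (laurent_sumM s0 (laurent_sum_adjoint laurent_sum_expN)
  (laurent_sum_adjoint laurent_sum_g)) => z _.
by rewrite -rmorphM mulKf // exp_neq0.
Qed.

Hypothesis t_adm : admissible mu t.

(** Admissibility makes the set of factorizations inhabited, so the chosen triple is a genuine
    one. *)
Lemma gauss_borel_at : gauss_borel (moment_matrix_at mu t) (Sm mu t) (Hm mu t) (hSm mu t).
Proof.
have [S [H [T SHT]]] := t_adm.
exact: (xgetPex (smx1 R (D:=D), smx1 R (D:=D), smx1 R (D:=D))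
  (ex_intro (fun X => gauss_borel (moment_matrix_at mu t) X.1.1 X.1.2 X.2) (S, H, T) SHT)).
Qed.

Lemma factorization_at :
  exists N, factorization (toep g) (Sm mu t) (Hm mu t) (hSm mu t) N.
Proof. by rewrite -moment_matrix_atE; exact: gauss_borel_factorization gauss_borel_at. Qed.

Lemma factorization_adj : exists N,
  factorization (toep (coef_adj g)) (hSm mu t) (dagger (Hm mu t)) (Sm mu t) N.
Proof.
rewrite -dagger_toep -moment_matrix_atE.
exact: gauss_borel_factorization (gauss_borel_dagger gauss_borel_at).
Qed.

Lemma block_lower_Sm : block_lower (Sm mu t).
Proof. by have [N []] := factorization_at. Qed.

Lemma block_lower_hSm : block_lower (hSm mu t).
Proof. by have [N []] := factorization_at. Qed.

Lemma block_lower_hW2inv : block_lower (dagger (sinv (hW2 mu t))).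
Proof.
by have [N [_ _ Nu _ _ NE]] := factorization_at; rewrite /hW2 NE; exact: block_lower_dagger.
Qed.

Lemma block_lower_W2inv : block_lower (dagger (sinv (W2 mu t))).
Proof.
by have [N [_ _ Nu _ _ NE]] := factorization_adj; rewrite /W2 NE; exact: block_lower_dagger.
Qed.

Variable z : 'rV[C]_D.
Hypothesis zr : on_torus r z.

Let z0 i : z 0 i != 0. Proof. exact: on_torus_neq0 zr. Qed.
(** The reflected point: there the adjoint symbol [coef_adj u] takes the conjugate of the value of
    [u] at [z]. *)
Let w := zinv (zbar z).
Let ws : on_torus (rinv r) w. Proof. exact/on_torus_inv/on_torus_conj. Qed.
Let w0 i : w 0 i != 0. Proof. exact: on_torus_neq0 (rinv_gt0 r0) ws. Qed.
Let wE : zinv (zbar w) = z. Proof. exact: zinv_zbarK. Qed.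

Lemma sapp_symbol P u F a : block_lower P -> laurent_sum r u F ->
  sapp (smul P (toep u)) (chi z) a = sapp P (chi z) a * F z.
Proof.
move=> Pl ur; rewrite -(laurent_sumE ur zr); apply: sapp_toep => //.
by have [] := ur _ zr.
Qed.

Lemma sapp_symbol_adj P u F a : block_lower P -> laurent_sum r u F ->
  sapp (smul P (toep (coef_adj u))) (chi w) a = sapp P (chi w) a * (F z)^*.
Proof.
move=> Pl ur; have us := laurent_sum_adjoint ur.
rewrite -[in F z]wE -(laurent_sumE us ws); apply: sapp_toep => //.
by have [] := us _ ws.
Qed.

Lemma Psi1E a : Psi1 mu t z a = Phi mu t z a * E z.
Proof. rewrite /Psi1 /W1 W0E; apply: sapp_symbol laurent_sum_exp; exact: block_lower_Sm. Qed.

Lemma hPsi1E a : hPsi1 mu t w a = hPhi mu t w a * (E z)^*.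
Proof.
rewrite /hPsi1 /hW1 W0E dagger_toep.
apply: sapp_symbol_adj laurent_sum_exp; exact: block_lower_hSm.
Qed.

Lemma hPsi2E a : hPsi2 mu t z a = Phi mu t z a * (E z * M z).
Proof.
have [N [Sl _ _ SG _ _]] := factorization_at.
by rewrite /hPsi2 /hW2 SG; apply: sapp_symbol laurent_sum_g.
Qed.

Lemma Psi2E a : Psi2 mu t w a = hPhi mu t w a * (E z * M z)^*.
Proof.
have [N [Sl _ _ SG _ _]] := factorization_adj.
by rewrite /Psi2 /W2 SG; apply: sapp_symbol_adj laurent_sum_g.
Qed.

(** [W1inv = W0inv (G N)] collapses to the Toeplitz matrix of [m] times [N]; its adjoint is
    [N^dagger], the matrix of [hPsi2s], times a Toeplitz matrix. *)
Lemma Psi1sE a : Psi1s mu t w a = hPsi2s mu t w a * (M z)^*.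
Proof.
have [N [_ _ Nu _ GN NE]] := factorization_at.
have [ae _] := laurent_sum_expN zr; have [ag _] := laurent_sum_g zr.
rewrite /Psi1s /hPsi2s /W1inv /hW2 NE GN W0invE (smul_toepA z0) //.
rewrite (smul_toep z0) // expN_g dagger_smul_upper // dagger_toep.
by apply: sapp_symbol_adj laurent_sum_m; exact: block_lower_dagger.
Qed.

(** The same collapse for the adjoint factorization, whose [N] is the inverse of [W2]. The symbol is
    conjugated twice, so the formula is read at [z] itself. *)
Lemma hPsi1sE a : hPsi1s mu t z a = Psi2s mu t z a * M z.
Proof.
have [N [_ _ Nu _ GN NE]] := factorization_adj.
have [ae _] := laurent_sum_adjoint laurent_sum_expN ws.
have [ag _] := laurent_sum_adjoint laurent_sum_g ws.
rewrite /hPsi1s /Psi2s /hW1inv /W2 NE GN W0invE dagger_toep (smul_toepA w0) //.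
rewrite (smul_toep w0) // expN_g_adj dagger_smul_upper // -dagger_toep daggerK.
by apply: sapp_symbol laurent_sum_m; exact: block_lower_dagger.
Qed.

End AtRadius.

End MomentMatrix.

(** * Comparison of two contours *)

Section Contours.
Variables (R : realType) (D : nat).
Local Notation C := (Cplx R).
Local Notation point := 'rV[C]_D.
Local Notation mx := (smx R D).

(** [K] is a common expression for the left integrand at [z] and the right one at [1 / z], with one
    Laurent expansion on both tori. *)
Lemma oint_inv (r r' : 'rV[R]_D) (F F' : point -> mx) a b (K : point -> C) :
  laurent_on [set r; r']%classic K ->
  (forall z, on_torus r z -> F z a b = K z) ->
  (forall z, on_torus r' z -> F' (zinv z) a b = K z) ->
  oint r F a b = oint (rinv r') F' a b.
Proof.
move=> [u uK] FK F'K; have [r0 ur] := uK r (or_introl erefl).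
have [r'0 ur'] := uK r' (or_intror erefl).
apply: (torus_integral_inv (F := K) (G := K) r0 (rinv_gt0 r'0) ur).
- by rewrite rinvK.
- by move=> z /FK ->.
- move=> z zs; rewrite -F'K ?zinvK //.
  by rewrite -(rinvK r'); exact: on_torus_inv.
Qed.

Lemma laurent_sumD (r : 'rV[R]_D) u v (F G : point -> C) :
  laurent_sum r u F -> laurent_sum r v G ->
  laurent_sum r (fun a => u a + v a) (fun z => F z + G z).
Proof.
move=> uF vG z zr; have [au hu] := uF _ zr; have [av hv] := vG _ zr.
have E : (fun a => (u a + v a) * monom a z) = (fun a => u a * monom a z + v a * monom a z).
  by apply/funext => a; rewrite mulrDl.
by rewrite E; split; [exact: abs_summableD|exact: hsumD].
Qed.

End Contours.

Theorem theorem4p3 (R : realType) (D : nat) (D_ge1 : (1 <= D)%N)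
    (mu : complex_measure R (torus_angles R D))
    (c c' : 'rV[Cplx R]_D) (t t' : 'rV[int]_D -> Cplx R)
    (c_dom : reinhardt_domain mu c) (c'_dom : reinhardt_domain mu c')
    (t_cvg : forall z, z \in [:: const_mx 1; c; c'] ->
       laurent_summable t z /\ laurent_summable t' z)
    (t_adm : admissible mu t) (t'_adm : admissible mu t') :
  let r := polyradius c in
  let s := rinv (polyradius c') in
  [/\ oint r (fun z => outer (Psi1 mu t z) (Psi1s mu t' (zinv (zbar z))))
      =2 oint s (fun z => outer (hPsi2 mu t (zinv z)) (hPsi2s mu t' (zbar z))),
      oint r (fun z => outer (Psi2 mu t (zinv z)) (Psi2s mu t' (zbar z)))
      =2 oint s (fun z => outer (hPsi1 mu t z) (hPsi1s mu t' (zinv (zbar z)))),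
      oint r (fun z => outer (Psi1 mu t z) (Psi2 mu t' (zinv (zbar z))))
      =2 oint s (fun z => outer (hPsi2 mu t (zinv z)) (hPsi1 mu t' (zbar z))) &
      oint r (fun z => outer (Psi2s mu t z) (Psi1s mu t' (zinv (zbar z))))
      =2 oint s (fun z => outer (hPsi1s mu t (zinv z)) (hPsi2s mu t' (zbar z)))]
  /\
  [/\ oint r (fun z => sscale (cexp (laurent t z) * mu_hat mu z)
        (outer (Phi mu t z) (hPhi mu t' (zinv (zbar z)))))
      =2 oint s (fun z =>
        sscale (cexp (laurent t (zinv z)) * mu_hat mu (zinv z))
          (outer (Phi mu t (zinv z)) (hPhi mu t' (zbar z)))),
      oint r (fun z =>
        sscale (cexp (laurent (coef_conj t) z) * mu_hat_bar mu z)
          (outer (hPhi mu t (zinv z)) (Phi mu t' (zbar z))))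
      =2 oint s (fun z =>
        sscale (cexp (laurent (coef_conj t) (zinv z)) * mu_hat_bar mu (zinv z))
          (outer (hPhi mu t z) (Phi mu t' (zinv (zbar z))))),
      oint r (fun z =>
        sscale (cexp (laurent (fun a => t a + t' a) z) * mu_hat mu z)
          (outer (Phi mu t z) (hPhi mu t' (zinv (zbar z)))))
      =2 oint s (fun z =>
        sscale (cexp (laurent (fun a => t a + t' a) (zinv z))
                * mu_hat mu (zinv z))
          (outer (Phi mu t (zinv z)) (hPhi mu t' (zbar z)))) &
      oint r (fun z => sscale (mu_hat mu z)
        (outer (Phi mu t z) (hPhi mu t' (zinv (zbar z)))))
      =2 oint s (fun z => sscale (mu_hat mu (zinv z))
          (outer (Phi mu t (zinv z)) (hPhi mu t' (zbar z))))].
Proof.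
move=> r s; pose r' := polyradius c'.
have dom (z : 'rV[Cplx R]_D) : reinhardt_domain mu z ->
    (forall i, z 0 i != 0) /\ laurent_summable (fourier mu) z.
  by move/interior_subset.
have [c0 c_sum] := dom _ c_dom; have [c'0 c'_sum] := dom _ c'_dom.
have [tc t'c] : laurent_summable t c /\ laurent_summable t' c.
  by apply: t_cvg; rewrite !inE eqxx orbT.
have [tc' t'c'] : laurent_summable t c' /\ laurent_summable t' c'.
  by apply: t_cvg; rewrite !inE eqxx !orbT.
(* All the series involved converge at both radii, including those with coefficients [t + t'] and
   with conjugated coefficients. *)
have cvg q : q \in [:: r; r'] ->
    [/\ convergent_at mu t q, convergent_at mu t' q,
        convergent_at mu (fun a => t a + t' a) q, convergent_at mu (coef_conj t) q &
        laurent_sum q (coef_conj (fourier mu)) (mu_hat_bar mu)].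
  move=> qA.
  have [q0 qt qt' qm] : [/\ forall i, 0 < q 0 i, laurent_sum q t (laurent t),
      laurent_sum q t' (laurent t') & laurent_sum q (fourier mu) (mu_hat mu)].
    move: qA; rewrite !inE => /orP[] /eqP ->.
      by split; [exact: polyradius_gt0|exact: laurent_sum_polyradius..].
    by split; [exact: polyradius_gt0|exact: laurent_sum_polyradius..].
  split; try by split.
  - by split=> //; exact: laurent_sum_laurent (laurent_sumD qt qt').
  - by split=> //; exact: laurent_sum_laurent (laurent_sum_conj qt).
  - exact: laurent_sum_laurent (laurent_sum_conj qm).
have [ct ct' ctt' ctb _] := cvg r (mem_head _ _).
have r'A : r' \in [:: r; r'] by rewrite !inE eqxx orbT.
have [c't c't' _ _ _] := cvg r' r'A.
pose A := [set r; r']%classic.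
have cvgA q : A q -> q \in [:: r; r'] by rewrite !inE => -[] ->; rewrite eqxx ?orbT.
have A0 q : A q -> forall i, 0 < q 0 i by move=> /cvgA/cvg[[]].
have onE u : (forall q, q \in [:: r; r'] -> convergent_at mu u q) ->
    laurent_on A (fun z => cexp (laurent u z)).
  move=> uA; exists (exp_coef u) => q qA; split; first exact: A0.
  exact: laurent_sum_exp (uA _ (cvgA _ qA)).
have Et : laurent_on A (fun z => cexp (laurent t z)) by apply: onE => q /cvg[].
have Et' : laurent_on A (fun z => cexp (laurent t' z)) by apply: onE => q /cvg[].
have Ett' : laurent_on A (fun z => cexp (laurent (fun a => t a + t' a) z)).
  by apply: onE => q /cvg[].
have Etb : laurent_on A (fun z => cexp (laurent (coef_conj t) z)) by apply: onE => q /cvg[].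
have onmu : laurent_on A (mu_hat mu).
  by exists (fourier mu) => q qA; split; [exact: A0|have [[]] := cvg _ (cvgA _ qA)].
have onmub : laurent_on A (mu_hat_bar mu).
  by exists (coef_conj (fourier mu)) => q qA; split; [exact: A0|have [] := cvg _ (cvgA _ qA)].
have onM : laurent_on A (fun z => ((2 * pi) ^+ D)%:C%C * mu_hat mu z).
  exists (moment_coef mu) => q qA; split; first exact: A0.
  by have [/laurent_sum_m] := cvg _ (cvgA _ qA).
have on_sapp P a : block_lower P -> laurent_on A (fun z => sapp P (chi z) a).
  exact: laurent_on_sapp.
have on_sapp_inv P a : block_lower P -> laurent_on A (fun z => sapp P (chi (zinv z)) a).
  exact: laurent_on_sapp_inv.
have St := block_lower_Sm ct t_adm; have St' := block_lower_Sm ct' t'_adm.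
have Tt := block_lower_hSm ct t_adm; have Tt' := block_lower_hSm ct' t'_adm.
have Nt' := block_lower_hW2inv ct' t'_adm.
have Mt := block_lower_W2inv ct t_adm; have Mt' := block_lower_W2inv ct' t'_adm.
(* The Baker formulas are stated at [z] and [1 / zbar], the second identity at [1 / z] and [zbar];
   conjugation preserves the torus and matches them. *)
have conj_torus (q : 'rV[R]_D) (P : 'rV[Cplx R]_D -> Prop) :
    (forall z, on_torus q z -> P (zbar z)) -> forall z, on_torus q z -> P z.
  by move=> h z /on_torus_conj/h; rewrite zbarK.
split; split=> a b.
(* The symbol [M] of the measure comes from [Psi1s] on the left and from [hPsi2] on the right; the
   other factors agree. *)
- apply: (oint_inv (K := fun z => Phi mu t z a * cexp (laurent t z) *
    ((hPsi2s mu t' (zinv (zbar z)) b)^* * (((2 * pi) ^+ D)%:C%C * mu_hat mu z)))).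
  + apply: laurent_onM; apply: laurent_onM => //; first exact: on_sapp.
    exact: laurent_on_conj (on_sapp_inv _ b Nt').
  + move=> z zr; rewrite /outer (Psi1E ct t_adm zr) (Psi1sE ct' t'_adm zr).
    by rewrite rmorphM /= conjCK.
  + move=> z zr; rewrite /outer zinvK zbar_inv (hPsi2E c't t_adm zr).
    by ring.
- apply: (oint_inv (K := fun z => hPhi mu t (zinv z) a *
    (cexp (laurent t (zbar z)) * (((2 * pi) ^+ D)%:C%C * mu_hat mu (zbar z)))^* *
    (Psi2s mu t' (zbar z) b)^*)).
  + apply: laurent_onM; last exact: laurent_on_conj (on_sapp _ b Mt').
    apply: laurent_onM; first exact: on_sapp_inv.
    exact: laurent_on_conj (laurent_onM Et onM).
  + apply: conj_torus => z zr.
    by rewrite /outer zbarK (Psi2E ct t_adm zr).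
  + apply: conj_torus => z zr.
    rewrite /outer zinv_zbarK zbarK (hPsi1E c't t_adm zr) (hPsi1sE c't' t'_adm zr).
    by rewrite !rmorphM /=; ring.
(* Here [e^t] and [e^t'] both occur: [Psi2] supplies [e^t' M] on the left, [hPsi2] supplies [e^t M]
   on the right. *)
- apply: (oint_inv (K := fun z => Phi mu t z a * cexp (laurent t z) *
    ((hPhi mu t' (zinv (zbar z)) b)^* *
     (cexp (laurent t' z) * (((2 * pi) ^+ D)%:C%C * mu_hat mu z))))).
  + apply: laurent_onM; apply: laurent_onM; rewrite //; [exact: on_sapp| |exact: laurent_onM].
    exact: laurent_on_conj (on_sapp_inv _ b Tt').
  + move=> z zr; rewrite /outer (Psi1E ct t_adm zr) (Psi2E ct' t'_adm zr).
    by rewrite [X in _ * X = _]rmorphM /= conjCK.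
  + move=> z zr; rewrite /outer zinvK zbar_inv (hPsi2E c't t_adm zr) (hPsi1E c't' t'_adm zr).
    by rewrite [X in _ * X = _]rmorphM /= conjCK; ring.
- apply: (oint_inv (K := fun z => Psi2s mu t z a *
    ((hPsi2s mu t' (zinv (zbar z)) b)^* * (((2 * pi) ^+ D)%:C%C * mu_hat mu z)))).
  + apply: laurent_onM; first exact: on_sapp.
    by apply: laurent_onM => //; exact: laurent_on_conj (on_sapp_inv _ b Nt').
  + move=> z zr; rewrite /outer (Psi1sE ct' t'_adm zr).
    by rewrite [X in _ * X = _]rmorphM /= conjCK.
  + move=> z zr; rewrite /outer zinvK zbar_inv (hPsi1sE c't t_adm zr).
    by ring.
(* In the last four identities [K] is the left integrand itself, and the right one is literally its
   value at [1 / z]. *)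
- apply: (oint_inv (K := fun z => cexp (laurent t z) * mu_hat mu z *
    (Phi mu t z a * (hPhi mu t' (zinv (zbar z)) b)^*))) => [|//|z _].
  + apply: laurent_onM; first exact: laurent_onM.
    by apply: laurent_onM; [exact: on_sapp|exact: laurent_on_conj (on_sapp_inv _ b Tt')].
  + by rewrite /sscale /outer zinvK zbar_inv.
- apply: (oint_inv (K := fun z => cexp (laurent (coef_conj t) z) * mu_hat_bar mu z *
    (hPhi mu t (zinv z) a * (Phi mu t' (zbar z) b)^*))) => [|//|z _].
  + apply: laurent_onM; first exact: laurent_onM.
    by apply: laurent_onM; [exact: on_sapp_inv|exact: laurent_on_conj (on_sapp _ b St')].
  + by rewrite /sscale /outer zinvK zbar_inv zinvK.
- apply: (oint_inv (K := fun z => cexp (laurent (fun a => t a + t' a) z) * mu_hat mu z *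
    (Phi mu t z a * (hPhi mu t' (zinv (zbar z)) b)^*))) => [|//|z _].
  + apply: laurent_onM; first exact: laurent_onM.
    by apply: laurent_onM; [exact: on_sapp|exact: laurent_on_conj (on_sapp_inv _ b Tt')].
  + by rewrite /sscale /outer zinvK zbar_inv.
- apply: (oint_inv (K := fun z => mu_hat mu z *
    (Phi mu t z a * (hPhi mu t' (zinv (zbar z)) b)^*))) => [|//|z _].
  + apply: laurent_onM => //.
    by apply: laurent_onM; [exact: on_sapp|exact: laurent_on_conj (on_sapp_inv _ b Tt')].
  + by rewrite /sscale /outer zinvK zbar_inv.
Qed.
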